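(* Let $(\beta_i)_{i=1}^\infty$ be any sequence in $(1,2)$ such that the $\beta_i$-expansion of $1$ terminates for each $i$, let $(m_i)_{i=1}^\infty$ be a sequence in $\mathbb N$, and let $(\bar p_i)_{i=1}^\infty$ be such that $\bar p_i\in[0,1]^{2^{m_i}}$ for each $i$. Then \[ \dim_H\Big(\bigcap_{i=1}^\infty\{x: \bar p_i\in A^{\beta_i,m_i}(x)\}\Big)=\inf_i \dim_H\big(\{x:\bar p_i\in A^{\beta_i,m_i}(x)\}\big). \]
   Context: For $\beta\in(1,2)$ let $f_\beta(x)=\beta x \bmod 1$ on $[0,1)$ and, for $x\in[0,1]$, $d_n(x,\beta)=\lfloor \beta f_\beta^n(x)\rfloor$, $n\ge 0$; the sequence $d(x,\beta)=(d_n(x,\beta))_{n\ge0}\in\{0,1\}^{\mathbb N}$ is the $\beta$-expansion of $x$, and $x=\sum_{k\ge0} d_k(x,\beta)\beta^{-(k+1)}$. The expansion of $1$ terminates if $d(1,\beta)=j_0\dots j_{k-1}0^\infty$ for some finite word. For $x$ with $\beta$-expansion $(x_i)_{i\ge0}$, a word $w$ of length $m$ and $n>m$, $\tau^\beta_w(x,n)=\#\{i\in\{0,\dots,n-m-1\}: x_i\dots x_{i+m-1}=w\}$. Enumerating the $2^m$ binary words of length $m$ as $w_1,\dots,w_{2^m}$, $A^{\beta,m}(x)$ denotes the set of accumulation points in $[0,1]^{2^m}$ of the vectors $\big(\tau^\beta_{w_j}(x,n)/(n-m)\big)_{j=1}^{2^m}$ as $n\to\infty$. *)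

(* Defs.v *)
From Stdlib Require Import Reals Lra Lia ZArith Arith List Classical ClassicalEpsilon.
Open Scope R_scope.

(* floor via Int_part (Int_part r = up r - 1 = floor r) *)
Definition fbeta (b x : R) : R := b * x - IZR (Int_part (b * x)).

Definition orbit (b : R) (n : nat) (x : R) : R := Nat.iter n (fbeta b) x.

Definition digit (b x : R) (n : nat) : Z := Int_part (b * orbit b n x).

Definition expansion_of_one_terminates (b : R) : Prop :=
  exists k : nat, forall n : nat, (k <= n)%nat -> digit b 1 n = 0%Z.

(* Enumeration of the 2^m binary words of length m: the word with index
   j < 2^m has k-th letter (k < m) equal to bit k of j. *)
Definition word_letter (j k : nat) : Z := Z.b2z (Nat.testbit j k).

Definition occurs_at (b x : R) (m j i : nat) : bool :=
  forallb (fun k => Z.eqb (digit b x (i + k)) (word_letter j k)) (seq 0 m).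

Definition tau (b x : R) (m j n : nat) : nat :=
  length (filter (occurs_at b x m j) (seq 0 (n - m))).

Definition freq (b x : R) (m j n : nat) : R := INR (tau b x m j n) / INR (n - m).

Definition in_A (b : R) (m : nat) (x : R) (p : nat -> R) : Prop :=
  forall eps : R, 0 < eps -> forall N : nat, exists n : nat,
    (N < n)%nat /\ (m < n)%nat /\
    forall j : nat, (j < 2 ^ m)%nat -> Rabs (freq b x m j n - p j) < eps.

Definition rpow (r s : R) : R := if Rle_dec r 0 then 0 else Rpower r s.

(* H^s(E) = 0, i.e. for every delta > 0, H^s_delta(E) = 0:
   for each eps > 0 there is a countable cover (U_k) of E with
   diam U_k <= r_k <= delta and sum_k r_k^s <= eps. *)
Definition Hnull (s : R) (E : R -> Prop) : Prop :=
  forall delta eps : R, 0 < delta -> 0 < eps ->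
    exists (U : nat -> R -> Prop) (r : nat -> R),
      (forall x, E x -> exists k, U k x) /\
      (forall k, 0 <= r k <= delta) /\
      (forall k x y, U k x -> U k y -> Rabs (x - y) <= r k) /\
      (forall N, sum_f_R0 (fun k => rpow (r k) s) N <= eps).

Definition is_inf (S : R -> Prop) (d : R) : Prop :=
  (forall s, S s -> d <= s) /\ (forall b, (forall s, S s -> b <= s) -> b <= d).

Definition dimH (E : R -> Prop) : R :=
  epsilon (inhabits 0) (is_inf (fun s => 0 < s /\ Hnull s E)).

Definition freq_set (b : R) (m : nat) (p : nat -> R) (x : R) : Prop :=
  0 <= x <= 1 /\ in_A b m x p.

(* Main.v *)
Require Import Defs.
From Stdlib Require Import Reals Lra Lia ZArith Arith List Cantor Classical ClassicalEpsilon.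
Open Scope R_scope.

(** Let [s < 1] be such that no frequency set [F_i] is [s]-null. A frequency set
    depends only on the tail of the orbit, and because the expansion of [1]
    terminates every interval [I] contains a comparably long interval mapped
    affinely onto [0, 1) by an iterate of [f_beta]; so [F_i] meets [I] in a set of
    [s]-content at least [c_i |I|^s]. Up to a countable set, [F_i] is the
    intersection over [q] of the interiors of the sets [G_(i,q)] of points having
    some [n > q] at which the frequencies are within [1/(q+1)] of [p_i].

    A Baire argument then handles all the [G_(i,q)] at once. Given dyadic intervals
    [U_k] of small total weight [sum |U_k|^s], one chooses nested dyadic intervals
    [I_n], the next one inside the next [G_(i,q)], none contained in a [U_k], and
    such that the [U_k] inside [I_n] have total weight at most [|I_n|^s / 2]. The
    limit point lies in every [F_i] and in no [U_k]. *)

(** * Hausdorff null sets and dimension *)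

Lemma rpow_pos_eq r s : 0 < r -> rpow r s = Rpower r s.
Proof. intros Hr; unfold rpow; destruct (Rle_dec r 0); lra. Qed.

Lemma rpow_0 s : rpow 0 s = 0.
Proof. unfold rpow; destruct (Rle_dec 0 0); lra. Qed.

Lemma Rpower_pos x y : 0 < Rpower x y.
Proof. apply exp_pos. Qed.

Lemma rpow_ge0 r s : 0 <= rpow r s.
Proof. unfold rpow; destruct (Rle_dec r 0); [lra | left; apply Rpower_pos]. Qed.

Lemma rpow_gt0 r s : 0 < r -> 0 < rpow r s.
Proof. intros; rewrite rpow_pos_eq by easy; apply Rpower_pos. Qed.

Lemma rpow_mult r c s : 0 <= r -> 0 < c -> rpow (r * c) s = rpow r s * rpow c s.
Proof.
  intros [Hr | <-] Hc; [| rewrite Rmult_0_l, rpow_0; ring].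
  rewrite !rpow_pos_eq by (auto using Rmult_lt_0_compat).
  symmetry; apply Rpower_mult_distr; easy.
Qed.

Lemma rpow_lt r r' s : 0 < s -> 0 <= r < r' -> rpow r s < rpow r' s.
Proof.
  intros Hs [[Hr | <-] Hr'].
  - rewrite !rpow_pos_eq by lra; apply Rlt_Rpower_l; lra.
  - rewrite rpow_0; apply rpow_gt0; easy.
Qed.

Lemma rpow_le r r' s : 0 < s -> 0 <= r <= r' -> rpow r s <= rpow r' s.
Proof.
  intros Hs [Hr [Hlt | ->]]; [left; apply rpow_lt; lra | lra].
Qed.

Lemma sum_nonneg f N : (forall n, 0 <= f n) -> 0 <= sum_f_R0 f N.
Proof. intros Hf; apply cond_pos_sum; easy. Qed.

Lemma sum_le_mono f N M :
  (forall n, 0 <= f n) -> (N <= M)%nat -> sum_f_R0 f N <= sum_f_R0 f M.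
Proof.
  intros Hf; induction 1 as [| M _ IH]; [lra |].
  simpl; specialize (Hf (S M)); lra.
Qed.

Lemma term_le_sum f N : (forall n, 0 <= f n) -> f N <= sum_f_R0 f N.
Proof.
  intros Hf; destruct N as [| N]; simpl; [lra |].
  pose proof (sum_nonneg f N Hf); lra.
Qed.

Definition interleave {A : Type} (f g : nat -> A) (n : nat) : A :=
  if Nat.even n then f (Nat.div2 n) else g (Nat.div2 n).

Lemma interleave_even {A : Type} (f g : nat -> A) k : interleave f g (2 * k) = f k.
Proof. unfold interleave. now rewrite Nat.even_even, Nat.div2_double. Qed.

Lemma interleave_odd {A : Type} (f g : nat -> A) k : interleave f g (S (2 * k)) = g k.
Proof.
  unfold interleave; rewrite Nat.div2_succ_double.
  replace (S (2 * k)) with (2 * k + 1)%nat by lia. now rewrite Nat.even_odd.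
Qed.

Lemma interleave_cases {A : Type} (f g : nat -> A) n :
  exists k, interleave f g n = f k \/ interleave f g n = g k.
Proof. exists (Nat.div2 n); unfold interleave; destruct (Nat.even n); auto. Qed.

Lemma sum_interleave_le f g N :
  (forall n, 0 <= f n) -> (forall n, 0 <= g n) ->
  sum_f_R0 (interleave f g) N <= sum_f_R0 f N + sum_f_R0 g N.
Proof.
  intros Hf Hg.
  (* Up to index [2 * K + 1] both families contribute [K + 1] terms, so the sum splits exactly; the
     index [N] is then dominated by [2 * N + 1]. *)
  assert (Heq : forall K, sum_f_R0 (interleave f g) (S (2 * K))
                          = sum_f_R0 f K + sum_f_R0 g K).
  { induction K as [| K IH]; [reflexivity |].
    replace (2 * S K)%nat with (S (S (2 * K))) by lia.
    rewrite tech5, tech5, IH, (tech5 f), (tech5 g).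
    replace (S (S (2 * K))) with (2 * S K)%nat by lia.
    rewrite interleave_even, interleave_odd; ring. }
  rewrite <- Heq; apply sum_le_mono; [| lia].
  intros n; destruct (interleave_cases f g n) as [k [-> | ->]]; auto.
Qed.

Lemma interleave_map {A B : Type} (h : A -> B) (f g : nat -> A) n :
  h (interleave f g n) = interleave (fun k => h (f k)) (fun k => h (g k)) n.
Proof. unfold interleave; now destruct (Nat.even n). Qed.

(* Covers of arbitrary mesh: since [s > 0], a small total weight already
   forces every [r k] to be small, so [delta] can be dropped. *)
Lemma not_Hnull_content s E :
  0 < s -> ~ Hnull s E ->
  exists c, 0 < c /\
    forall (e : nat -> R) (U : nat -> R -> Prop) (r : nat -> R),
      (forall x, E x -> (exists k, U k x) \/ (exists k, x = e k)) ->
      (forall k, 0 <= r k) ->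
      (forall k x y, U k x -> U k y -> Rabs (x - y) <= r k) ->
      exists N, c < sum_f_R0 (fun k => rpow (r k) s) N.
Proof.
  intros Hs Hnot.
  apply not_all_ex_not in Hnot as [delta Hnot].
  apply not_all_ex_not in Hnot as [eps Hnot].
  apply imply_to_and in Hnot as [Hdelta Hnot].
  apply imply_to_and in Hnot as [Heps Hnot].
  exists (Rmin eps (rpow delta s)); split.
  { apply Rmin_glb_lt; [easy | now apply rpow_gt0]. }
  intros e U r Hcov Hr Hdiam.
  apply NNPP; intros Hsmall.
  assert (Hle : forall N, sum_f_R0 (fun k => rpow (r k) s) N
                          <= Rmin eps (rpow delta s)).
  { intros N; apply Rnot_lt_le; eauto. }
  apply Hnot.
  (* Each exceptional point [e k] is covered by a singleton of radius 0, whose weight [rpow 0 s] is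
     0, so a countable set costs nothing. *)
  exists (interleave U (fun k x => x = e k)), (interleave r (fun _ => 0)).
  repeat split.
  - intros x Hx; destruct (Hcov x Hx) as [[k Hk] | [k Hk]].
    + exists (2 * k)%nat; now rewrite interleave_even.
    + exists (S (2 * k)); now rewrite interleave_odd.
  - destruct (interleave_cases r (fun _ => 0) k) as [j [-> | ->]]; [easy | lra].
  - destruct (interleave_cases r (fun _ => 0) k) as [j [-> | ->]]; [| lra].
    apply Rnot_lt_le; intros Hlt.
    pose proof (rpow_lt delta (r j) s Hs ltac:(lra)) as H1.
    pose proof (term_le_sum (fun k => rpow (r k) s) j (fun n => rpow_ge0 _ _)) as H2.
    simpl in H2; specialize (Hle j).
    pose proof (Rmin_r eps (rpow delta s)); lra.
  - intros k x y; unfold interleave; destruct (Nat.even k); [apply Hdiam |].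
    intros -> ->; rewrite Rminus_diag, Rabs_R0; lra.
  - intros N.
    rewrite (sum_eq _ (interleave (fun k => rpow (r k) s) (fun _ => 0))).
    2:{ intros i _; rewrite (interleave_map (fun t => rpow t s)).
        unfold interleave; now rewrite rpow_0. }
    eapply Rle_trans; [apply sum_interleave_le |].
    + intros; apply rpow_ge0.
    + intros; lra.
    + rewrite sum_cte; specialize (Hle N).
      pose proof (Rmin_l eps (rpow delta s)); lra.
Qed.

Lemma Hnull_incl s (E E' : R -> Prop) :
  (forall x, E x -> E' x) -> Hnull s E' -> Hnull s E.
Proof.
  intros Hincl HE' delta eps Hd He.
  destruct (HE' delta eps Hd He) as (U & r & Hcov & H); exists U, r; auto.
Qed.

Lemma sum_indicator_le n A N :
  0 <= A ->
  sum_f_R0 (fun k => if le_dec k n then A else 0) N <= INR (S n) * A.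
Proof.
  intros HA.
  assert (H : forall N, sum_f_R0 (fun k => if le_dec k n then A else 0) N
                        <= INR (Nat.min (S N) (S n)) * A).
  { clear N; induction N as [| N IH].
    - simpl sum_f_R0; destruct (le_dec 0 n); [| lia].
      replace (Nat.min 1 (S n)) with 1%nat by lia; simpl; lra.
    - rewrite tech5; destruct (le_dec (S N) n).
      + replace (Nat.min (S (S N)) (S n)) with (S (S N)) by lia.
        replace (Nat.min (S N) (S n)) with (S N) in IH by lia.
        rewrite (S_INR (S N)); lra.
      + replace (Nat.min (S (S N)) (S n)) with (S n) by lia.
        replace (Nat.min (S N) (S n)) with (S n) in IH by lia; lra. }
  eapply Rle_trans; [apply H |].
  apply Rmult_le_compat_r; [easy | apply le_INR; lia].
Qed.

(** The [n + 1] closed intervals of length [/ X], with [X = n + 1], have total weight [X ^ (1 - s)],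
    which tends to 0 since [s > 1]. *)
Lemma Hnull_unit s (E : R -> Prop) :
  1 < s -> (forall x, E x -> 0 <= x <= 1) -> Hnull s E.
Proof.
  intros Hs HE delta eps Hd He.
  destruct (INR_unbounded (Rmax (/ delta) (Rpower (/ eps) (/ (s - 1))))) as [n Hn].
  pose proof (Rmax_l (/ delta) (Rpower (/ eps) (/ (s - 1)))) as Hl.
  pose proof (Rmax_r (/ delta) (Rpower (/ eps) (/ (s - 1)))) as Hr.
  set (X := INR (S n)).
  assert (HnX : INR n + 1 = X) by (unfold X; rewrite S_INR; ring).
  assert (HX : 0 < X) by (unfold X; apply lt_0_INR; lia).
  exists (fun k x => (k <= n)%nat /\ INR k <= x * X <= INR k + 1),
         (fun k => if le_dec k n then / X else 0).
  assert (HXd : 0 < / X <= delta).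
  { split; [now apply Rinv_0_lt_compat |].
    rewrite <- (Rinv_inv delta); apply Rinv_le_contravar; [| lra].
    now apply Rinv_0_lt_compat. }
  repeat split.
  - intros x Hx; specialize (HE x Hx).
    (* The floor of [1 * X] is [n + 1], one index too far; the point 1 belongs to the last closed
       interval instead. *)
    destruct (Req_dec x 1) as [-> | Hx1].
    { exists n; split; [lia |]; lra. }
    assert (HxX : 0 <= x * X) by (apply Rmult_le_pos; lra).
    destruct (base_Int_part (x * X)) as [Hi1 Hi2].
    assert (Hz : (0 <= Int_part (x * X))%Z).
    { assert (H : (-1 < Int_part (x * X))%Z) by (apply lt_IZR; lra). lia. }
    exists (Z.to_nat (Int_part (x * X))).
    assert (Hc : INR (Z.to_nat (Int_part (x * X))) = IZR (Int_part (x * X))).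
    { rewrite INR_IZR_INZ, Z2Nat.id; easy. }
    rewrite Hc; repeat split; [| lra | lra].
    assert (Hlt : INR (Z.to_nat (Int_part (x * X))) < X).
    { rewrite Hc; apply Rle_lt_trans with (x * X); [lra |].
      rewrite <- (Rmult_1_l X) at 2; apply Rmult_lt_compat_r; lra. }
    apply INR_lt in Hlt; lia.
  - destruct (le_dec k n); lra.
  - destruct (le_dec k n); lra.
  - intros k x y [Hk Hx] [_ Hy]; destruct (le_dec k n); [| lia].
    apply Rmult_le_reg_r with X; [easy |].
    rewrite Rinv_l by lra.
    rewrite <- (Rabs_pos_eq X) by lra; rewrite <- Rabs_mult.
    apply Rabs_le; lra.
  - intros N.
    rewrite (sum_eq _ (fun k => if le_dec k n then rpow (/ X) s else 0)).
    2:{ intros i _; destruct (le_dec i n); auto using rpow_0. }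
    eapply Rle_trans; [apply sum_indicator_le, rpow_ge0 |].
    fold X; rewrite rpow_pos_eq by lra.
    assert (H1 : X * Rpower (/ X) s = / Rpower X (s - 1)).
    { unfold Rpower; rewrite ln_Rinv by easy.
      rewrite <- exp_Ropp; rewrite <- (exp_ln X) at 1 by easy.
      rewrite <- exp_plus; f_equal; ring. }
    rewrite H1, <- (Rinv_inv eps).
    apply Rinv_le_contravar; [now apply Rinv_0_lt_compat |].
    assert (H2 : / eps = Rpower (Rpower (/ eps) (/ (s - 1))) (s - 1)).
    { rewrite Rpower_mult, Rinv_l, Rpower_1; [easy | now apply Rinv_0_lt_compat | lra]. }
    rewrite H2; apply Rle_Rpower_l; [lra |]; split; [apply Rpower_pos | lra].
Qed.

(** The choice in [dimH] is meaningful because the infimum exists: 0 bounds the exponents from below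
    and 2 is one of them. [completeness] gives suprema, hence the negated exponents. *)
Lemma dimH_spec (E : R -> Prop) :
  (forall x, E x -> 0 <= x <= 1) -> is_inf (fun s => 0 < s /\ Hnull s E) (dimH E).
Proof.
  intros HE; unfold dimH; apply epsilon_spec.
  destruct (completeness (fun t => 0 < - t /\ Hnull (- t) E)) as [d [Hub Hlub]].
  - exists 0; intros t [Ht _]; lra.
  - exists (- 2); replace (- - 2) with 2 by lra; split; [lra |].
    apply Hnull_unit; [lra | easy].
  - exists (- d); split.
    + intros s [Hs HN]. cut (- s <= d); [lra |].
      apply Hub; rewrite Ropp_involutive; easy.
    + intros b Hb. cut (d <= - b); [lra |].
      apply Hlub; intros t Ht; specialize (Hb (- t) Ht); lra.
Qed.

Lemma dimH_le_1 (E : R -> Prop) : (forall x, E x -> 0 <= x <= 1) -> dimH E <= 1.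
Proof.
  intros HE; destruct (dimH_spec E HE) as [Hlow _].
  apply Rnot_lt_le; intros Hlt.
  specialize (Hlow ((1 + dimH E) / 2)
    ltac:(split; [lra | apply Hnull_unit; [lra | easy]])); lra.
Qed.

(** * Full branches *)

Lemma fbeta_range b x : 0 <= fbeta b x < 1.
Proof. unfold fbeta; destruct (base_Int_part (b * x)); lra. Qed.

Lemma fbeta_eq b x z y : b * x = IZR z + y -> 0 <= y < 1 -> fbeta b x = y.
Proof.
  intros H Hy; unfold fbeta.
  rewrite <- (Int_part_spec (b * x) z) by lra; lra.
Qed.

Lemma orbit_S b n x : orbit b (S n) x = fbeta b (orbit b n x).
Proof. reflexivity. Qed.

Lemma orbit_add b n k x : orbit b (n + k) x = orbit b n (orbit b k x).
Proof. apply Nat.iter_add. Qed.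

Lemma digit_add b n k x : digit b x (n + k) = digit b (orbit b k x) n.
Proof. unfold digit; now rewrite orbit_add. Qed.

Lemma orbit_range b n x : 0 <= x <= 1 -> 0 <= orbit b n x <= 1.
Proof.
  intros Hx; destruct n as [| n]; [easy |].
  rewrite orbit_S; pose proof (fbeta_range b (orbit b n x)); lra.
Qed.

(** Each of the [M] steps multiplies by [b] without a carry, so all these digits are 0. *)
Lemma orbit_scaled b M y : 1 < b -> 0 <= y < 1 -> orbit b M (y / b ^ M) = y.
Proof.
  intros Hb; revert y; induction M as [| M IH]; intros y Hy.
  - simpl; field.
  - assert (HbM : 0 < b ^ M) by (apply pow_lt; lra).
    assert (Hyb : 0 <= y / b < 1).
    { split; [apply Rmult_le_pos; [lra | left; apply Rinv_0_lt_compat; lra] |].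
      apply Rmult_lt_reg_r with b; [lra |]; unfold Rdiv.
      rewrite Rmult_assoc, Rinv_l; lra. }
    rewrite orbit_S.
    replace (y / b ^ S M) with (y / b / b ^ M) by (simpl; field; lra).
    rewrite IH by easy.
    apply (fbeta_eq _ _ 0); [field; lra | easy].
Qed.

(** The order-[n] cylinder around [x] is mapped affinely onto some [[0, t)] with [t] in the orbit of
    1. One more step maps [[0, t)] onto [[0, b * t)] if [b * t <= 1]. Otherwise the interval is cut
    at [/ b]: the left piece is mapped onto [[0, 1)] and the right one onto [[0, b * t - 1)], where
    [b * t - 1] is the next point of the orbit of 1. *)
Lemma orbit_branch b x n :
  1 < b < 2 -> 0 <= x < 1 ->
  exists a j, 0 <= a <= x /\ x < a + orbit b j 1 / b ^ n /\
    forall y, 0 <= y < orbit b j 1 -> orbit b n (a + y / b ^ n) = y.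
Proof.
  intros Hb Hx; induction n as [| n (a & j & Hax & Hxt & Hbr)].
  - exists 0, 0%nat; simpl; repeat split; try lra.
    intros y _; field.
  - assert (Hbn : 0 < b ^ n) by (apply pow_lt; lra).
    assert (Hib : 0 < / b) by (apply Rinv_0_lt_compat; lra).
    pose proof (orbit_range b j 1 ltac:(lra)) as Ht.
    set (t := orbit b j 1) in *.
    assert (Hlt : forall u v, u < v -> u / b < v / b).
    { intros u v Huv; apply Rmult_lt_compat_r; easy. }
    assert (Hnn : forall u, 0 <= u -> 0 <= u / b).
    { intros u Hu; apply Rmult_le_pos; lra. }
    assert (HS : forall y, y / b ^ S n = y / b / b ^ n) by (intros; simpl; field; lra).
    assert (Htb : b * t / b = t) by (field; lra).
    destruct (Rle_dec (b * t) 1) as [Hle | Hgt].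
    (* If [b * t = 1], then [fbeta b t] is 0 while the image has length 1; index 0 of the orbit
       supplies that length. *)
    + assert (Hj : exists j', orbit b j' 1 = b * t).
      { destruct (Req_dec (b * t) 1) as [H1 | H1]; [exists 0%nat; now rewrite H1 |].
        exists (S j); rewrite orbit_S; apply (fbeta_eq _ _ 0); fold t; [lra |].
        split; [apply Rmult_le_pos; lra | lra]. }
      destruct Hj as [j' Hj']; exists a, j'; rewrite Hj'.
      split; [easy |]; split.
      * rewrite HS, Htb; easy.
      * intros y Hy; rewrite orbit_S, HS, Hbr.
        -- apply (fbeta_eq _ _ 0); [field | ]; lra.
        -- rewrite <- Htb; split; [apply Hnn | apply Hlt]; lra.
    + destruct (Rlt_dec x (a + / b / b ^ n)) as [Hx1 | Hx1].
      * exists a, 0%nat; change (orbit b 0 1) with 1.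
        split; [easy |]; split.
        -- rewrite HS; unfold Rdiv at 2; now rewrite Rmult_1_l.
        -- intros y Hy; rewrite orbit_S, HS, Hbr.
           ++ apply (fbeta_eq _ _ 0); [field | ]; lra.
           ++ rewrite <- Htb; split; [apply Hnn | apply Hlt]; lra.
      * exists (a + / b / b ^ n), (S j).
        assert (HSj : orbit b (S j) 1 = b * t - 1).
        { rewrite orbit_S; apply (fbeta_eq _ _ 1); fold t; [lra |].
          split; [lra |].
          apply Rle_lt_trans with (b * 1 - 1); [| lra].
          apply Rplus_le_compat_r, Rmult_le_compat_l; lra. }
        rewrite HSj.
        assert (Hpos : 0 < / b / b ^ n) by (apply Rmult_lt_0_compat; [easy | now apply Rinv_0_lt_compat]).
        split; [lra |]; split.
        -- replace (a + / b / b ^ n + (b * t - 1) / b ^ S n) with (a + t / b ^ n)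
             by (simpl; field; lra); easy.
        -- intros y Hy.
           replace (a + / b / b ^ n + y / b ^ S n) with (a + (1 + y) / b / b ^ n)
             by (simpl; field; lra).
           rewrite orbit_S, Hbr.
           ++ apply (fbeta_eq _ _ 1); [field | ]; try lra.
              split; [lra |].
              assert (b * t <= b * 1) by (apply Rmult_le_compat_l; lra); lra.
           ++ rewrite <- Htb; split; [apply Hnn | apply Hlt]; lra.
Qed.

(** While the digits are 0 the orbit grows by the factor [b] at each step; being bounded by 1, it
    must already be 0. *)
Lemma orbit_of_one_vanishes b :
  1 < b -> expansion_of_one_terminates b ->
  exists k, forall n, (k <= n)%nat -> orbit b n 1 = 0.
Proof.
  intros Hb [k Hk]; exists k.
  assert (Hpow : forall j, orbit b (j + k) 1 = b ^ j * orbit b k 1).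
  { induction j as [| j IH]; [simpl; ring |].
    simpl plus; rewrite orbit_S; unfold fbeta.
    specialize (Hk (j + k)%nat ltac:(lia)); unfold digit in Hk.
    rewrite Hk, IH; simpl; ring. }
  pose proof (orbit_range b k 1 ltac:(lra)) as Ht.
  assert (H0 : orbit b k 1 = 0).
  { destruct (Req_dec (orbit b k 1) 0) as [| Hne]; [easy |].
    destruct (Pow_x_infinity b ltac:(rewrite Rabs_pos_eq; lra)
                (2 / orbit b k 1)) as [N HN].
    specialize (HN N ltac:(lia)).
    rewrite Rabs_pos_eq in HN by (apply pow_le; lra).
    pose proof (orbit_range b (N + k) 1 ltac:(lra)) as H1.
    rewrite Hpow in H1.
    assert (2 / orbit b k 1 * orbit b k 1 <= b ^ N * orbit b k 1)
      by (apply Rmult_le_compat_r; lra).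
    unfold Rdiv in H; rewrite Rmult_assoc, Rinv_l in H; lra. }
  intros n Hn; replace n with (n - k + k)%nat by lia.
  rewrite Hpow, H0; ring.
Qed.

Lemma pow_unbounded b X : 1 < b -> exists n, X <= b ^ n.
Proof.
  intros Hb.
  destruct (Pow_x_infinity b ltac:(rewrite Rabs_pos_eq; lra) X) as [n Hn].
  exists n; specialize (Hn n ltac:(lia)).
  rewrite Rabs_pos_eq in Hn by (apply pow_le; lra); lra.
Qed.

Lemma pow_mono b n m : 1 < b -> (n <= m)%nat -> b ^ n <= b ^ m.
Proof. intros; apply Rle_pow; [lra | easy]. Qed.

Lemma pow_first_above b X : 1 < b -> 1 <= X -> exists n, X <= b ^ n <= b * X.
Proof.
  intros Hb HX.
  destruct (pow_unbounded b X Hb) as [n Hn].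
  induction n as [| n IH].
  - exists 0%nat; simpl in *; split; [easy |].
    assert (1 * 1 <= b * X) by (apply Rmult_le_compat; lra); lra.
  - destruct (Rle_dec X (b ^ n)) as [Hle | Hgt]; [auto |].
    exists (S n); split; [easy |]; simpl.
    apply Rmult_le_compat_l; lra.
Qed.

(** The orbit of 1 is eventually 0, so only finitely many of its values are positive and they have a
    positive minimum. *)
Lemma orbit_of_one_bounded_below b :
  1 < b -> expansion_of_one_terminates b ->
  exists M, forall j, 0 < orbit b j 1 -> 1 / b ^ M <= orbit b j 1.
Proof.
  intros Hb Hterm.
  destruct (orbit_of_one_vanishes b Hb Hterm) as [k Hk].
  assert (H : forall k, exists M, forall j, (j < k)%nat -> 0 < orbit b j 1 ->
                1 <= orbit b j 1 * b ^ M).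
  { clear - Hb; intros k; induction k as [| k [M HM]]; [exists 0%nat; lia |].
    destruct (Rlt_dec 0 (orbit b k 1)) as [Hpos | Hnpos].
    - destruct (pow_unbounded b (/ orbit b k 1) Hb) as [M' HM'].
      exists (max M M'); intros j Hj Htj.
      destruct (Nat.eq_dec j k) as [-> | Hne].
      + rewrite <- (Rinv_r (orbit b k 1)) at 1 by lra.
        apply Rmult_le_compat_l; [lra |].
        eapply Rle_trans; [apply HM' | apply pow_mono; [easy | lia]].
      + eapply Rle_trans; [apply (HM j); [lia | easy] |].
        apply Rmult_le_compat_l; [lra | apply pow_mono; [easy | lia]].
    - exists M; intros j Hj Htj.
      destruct (Nat.eq_dec j k) as [-> | Hne]; [easy | apply HM; [lia | easy]]. }
  destruct (H k) as [M HM]; exists M; intros j Hj.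
  destruct (le_lt_dec k j) as [Hkj | Hkj]; [rewrite Hk in Hj by easy; lra |].
  assert (HbM : 0 < b ^ M) by (apply pow_lt; lra).
  apply Rmult_le_reg_r with (b ^ M); [easy |].
  unfold Rdiv; rewrite Rmult_assoc, Rinv_l by lra.
  rewrite Rmult_1_r; auto.
Qed.

(* Restricting a branch onto [0, t) to the preimage of [0, b^-M), which [M]
   further steps spread over [0, 1). *)
Lemma orbit_full_branch b :
  1 < b < 2 -> expansion_of_one_terminates b ->
  exists M, forall x n, 0 <= x < 1 ->
    exists a, 0 <= a <= x /\ x < a + 1 / b ^ n /\
      forall y, 0 <= y < 1 -> orbit b (M + n) (a + y / b ^ (M + n)) = y.
Proof.
  intros Hb Hterm.
  destruct (orbit_of_one_bounded_below b ltac:(lra) Hterm) as [M HM].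
  exists M; intros x n Hx.
  destruct (orbit_branch b x n Hb Hx) as (a & j & Ha & Hxa & Hbr).
  assert (Hbn : 0 < b ^ n) by (apply pow_lt; lra).
  assert (HbM : 0 < b ^ M) by (apply pow_lt; lra).
  assert (Hin : 0 < / b ^ n) by now apply Rinv_0_lt_compat.
  pose proof (orbit_range b j 1 ltac:(lra)) as Ht.
  assert (Htpos : 0 < orbit b j 1).
  { destruct (Req_dec (orbit b j 1) 0) as [H0 | H0]; [| lra].
    rewrite H0 in Hxa; unfold Rdiv in Hxa; lra. }
  exists a; split; [easy |]; split.
  - assert (orbit b j 1 / b ^ n <= 1 / b ^ n) by (apply Rmult_le_compat_r; lra); lra.
  - intros y Hy; rewrite orbit_add.
    replace (y / b ^ (M + n)) with (y / b ^ M / b ^ n)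
      by (rewrite pow_add; field; lra).
    assert (HiM : 0 < / b ^ M) by now apply Rinv_0_lt_compat.
    rewrite Hbr; [apply orbit_scaled; lra |].
    split; [apply Rmult_le_pos; lra |].
    apply Rlt_le_trans with (1 / b ^ M); [apply Rmult_lt_compat_r; lra | auto].
Qed.

(** * Frequency sets *)

Lemma occurs_at_shift b x m j L i :
  occurs_at b x m j (L + i) = occurs_at b (orbit b L x) m j i.
Proof.
  unfold occurs_at; induction (seq 0 m) as [| k l IH]; simpl; [easy |].
  rewrite IH; do 2 f_equal; rewrite <- digit_add; f_equal; lia.
Qed.

Lemma tau_shift b x m j L n :
  (m <= n)%nat ->
  (tau b (orbit b L x) m j n <= tau b x m j (L + n)
     <= L + tau b (orbit b L x) m j n)%nat.
Proof.
  intros Hmn; unfold tau.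
  replace (L + n - m)%nat with (L + (n - m))%nat by lia.
  rewrite seq_app, filter_app, length_app; simpl.
  pose proof (filter_length_le (occurs_at b x m j) (seq 0 L)) as H.
  rewrite length_seq in H.
  assert (Heq : forall k s, length (filter (occurs_at b x m j) (seq (L + s) k))
            = length (filter (occurs_at b (orbit b L x) m j) (seq s k))).
  { induction k as [| k IH]; intros s; simpl; [easy |].
    rewrite occurs_at_shift, plus_n_Sm.
    destruct (occurs_at b (orbit b L x) m j s); simpl; now rewrite IH. }
  specialize (Heq (n - m)%nat 0%nat); rewrite Nat.add_0_r in Heq; lia.
Qed.

Lemma tau_le b x m j n : (tau b x m j n <= n - m)%nat.
Proof.
  unfold tau; pose proof (filter_length_le (occurs_at b x m j) (seq 0 (n - m))).
  rewrite length_seq in H; easy.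
Qed.

(** The first [L] starting positions change the count by at most [L], and the denominator grows by
    [L]; both effects are of order [L / (n - m)]. *)
Lemma freq_shift b x m j L n :
  (m < n)%nat ->
  Rabs (freq b x m j (L + n) - freq b (orbit b L x) m j n) <= INR L / INR (n - m).
Proof.
  intros Hmn; unfold freq.
  destruct (tau_shift b x m j L n ltac:(lia)) as [Hlo Hhi].
  pose proof (tau_le b (orbit b L x) m j n) as Ht.
  apply le_INR in Hlo, Hhi, Ht; rewrite plus_INR in Hhi.
  replace (L + n - m)%nat with (L + (n - m))%nat by lia.
  rewrite plus_INR.
  assert (HD : 0 < INR (n - m)) by (apply lt_0_INR; lia).
  pose proof (pos_INR L) as HL.
  pose proof (pos_INR (tau b (orbit b L x) m j n)) as Ht0.
  set (l := INR L) in *; set (D := INR (n - m)) in *.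
  set (t := INR (tau b (orbit b L x) m j n)) in *.
  set (t' := INR (tau b x m j (L + n))) in *.
  replace (t' / (l + D) - t / D) with ((D * (t' - t) - l * t) / (D * (l + D)))
    by (field; lra).
  assert (HDD : 0 < D * (l + D)) by (apply Rmult_lt_0_compat; lra).
  assert (H1 : 0 <= l * t <= l * D)
    by (split; [apply Rmult_le_pos | apply Rmult_le_compat_l]; easy).
  assert (H2 : 0 <= D * (t' - t) <= D * l)
    by (split; [apply Rmult_le_pos | apply Rmult_le_compat_l]; lra).
  unfold Rdiv; rewrite Rabs_mult, (Rabs_pos_eq (/ (D * (l + D))))
    by (left; now apply Rinv_0_lt_compat).
  apply Rle_trans with (l * D * / (D * (l + D))).
  - apply Rmult_le_compat_r; [left; now apply Rinv_0_lt_compat |].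
    apply Rabs_le; lra.
  - replace (l * D * / (D * (l + D))) with (l * / (l + D)) by (field; lra).
    apply Rmult_le_compat_l; [easy |]; apply Rinv_le_contravar; lra.
Qed.

Lemma in_A_of_orbit b m p x L : in_A b m (orbit b L x) p -> in_A b m x p.
Proof.
  intros HA eps Heps N.
  (* Once [n - m] exceeds [K], the shift error [L / (n - m)] is at most [eps / 2]. *)
  destruct (INR_unbounded (2 * INR L / eps)) as [K HK].
  destruct (HA (eps / 2) ltac:(lra) (N + m + K)%nat) as (n & HnN & Hnm & Hn).
  exists (L + n)%nat; split; [lia |]; split; [lia |].
  intros j Hj; specialize (Hn j Hj).
  pose proof (freq_shift b x m j L n Hnm) as Hs.
  assert (HKn : INR K <= INR (n - m)) by (apply le_INR; lia).
  assert (HD : 0 < INR (n - m)) by (apply lt_0_INR; lia).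
  assert (Hsmall : INR L / INR (n - m) <= eps / 2).
  { apply Rmult_le_reg_r with (INR (n - m)); [easy |].
    unfold Rdiv at 1; rewrite Rmult_assoc, Rinv_l, Rmult_1_r by lra.
    apply Rle_trans with (eps / 2 * (2 * INR L / eps)).
    - right; field; lra.
    - apply Rmult_le_compat_l; lra. }
  replace (freq b x m j (L + n) - p j)
    with ((freq b x m j (L + n) - freq b (orbit b L x) m j n)
          + (freq b (orbit b L x) m j n - p j)) by ring.
  eapply Rle_lt_trans; [apply Rabs_triang | lra].
Qed.

(* A full branch over the given interval carries an affine copy of the whole
   frequency set. *)
Lemma freq_set_content b m p s :
  1 < b < 2 -> expansion_of_one_terminates b -> 0 < s ->
  ~ Hnull s (freq_set b m p) ->
  exists c, 0 < c /\
    forall u l, 0 <= u -> 0 < l -> u + l <= 1 ->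
    forall (e : nat -> R) (U : nat -> R -> Prop) (r : nat -> R),
      (forall x, u <= x < u + l -> freq_set b m p x ->
         (exists k, U k x) \/ (exists k, x = e k)) ->
      (forall k, 0 <= r k) ->
      (forall k x y, U k x -> U k y -> Rabs (x - y) <= r k) ->
      exists N, c * rpow l s < sum_f_R0 (fun k => rpow (r k) s) N.
Proof.
  intros Hb Hterm Hs Hnot.
  destruct (not_Hnull_content s _ Hs Hnot) as (c0 & Hc0 & Hcontent).
  destruct (orbit_full_branch b Hb Hterm) as (M & HM).
  assert (HbM : 0 < b ^ M) by (apply pow_lt; lra).
  (* Below, [b ^ n <= 2 * b / l < 4 / l], so the expansion factor satisfies
     [b ^ L * l <= 4 * b ^ M]; [C] bounds the resulting change of weights. *)
  set (C := rpow (4 * b ^ M) s).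
  assert (HC : 0 < C) by (apply rpow_gt0; lra).
  exists (c0 / C); split; [apply Rmult_lt_0_compat; [easy | now apply Rinv_0_lt_compat] |].
  intros u l Hu Hl Hul e U r Hcov Hr Hdiam.
  assert (Hil : 0 < / l) by now apply Rinv_0_lt_compat.
  assert (Hil1 : 1 <= / l) by (rewrite <- Rinv_1; apply Rinv_le_contravar; lra).
  (* With [1 / b ^ n <= l / 2], a branch of length at most [1 / b ^ n] near the midpoint [u + l / 2]
     stays inside [[u, u + l)]. *)
  destruct (pow_first_above b (2 * / l) ltac:(lra) ltac:(lra)) as (n & Hn1 & Hn2).
  destruct (HM (u + l / 2) n ltac:(lra)) as (a & Ha & Hxa & Hbr).
  set (L := (M + n)%nat) in *.
  assert (Hbn : 0 < b ^ n) by (apply pow_lt; lra).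
  assert (HbL : 0 < b ^ L) by (apply pow_lt; lra).
  assert (Hn3 : 1 / b ^ n <= l / 2).
  { replace (l / 2) with (/ (2 * / l)) by (field; lra).
    unfold Rdiv; rewrite Rmult_1_l; apply Rinv_le_contravar; lra. }
  assert (HLn : / b ^ L <= / b ^ n).
  { apply Rinv_le_contravar; [easy | apply pow_mono; [lra | unfold L; lia]]. }
  assert (HiL : 0 < / b ^ L) by now apply Rinv_0_lt_compat.
  (* The cover is pulled back along the branch. Slot 0 of the exceptional sequence is the point 1,
     which the half-open branch misses; the other slots are the pulled-back [e k]. *)
  destruct (Hcontent
     (fun k => match k with O => 1 | S k => (e k - a) * b ^ L end)
     (fun k y => U k (a + y / b ^ L)) (fun k => r k * b ^ L)) as [N HN].
  - intros y [Hy HAy].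
    destruct (Req_dec y 1) as [-> | Hy1]; [right; now exists 0%nat |].
    assert (Hy' : 0 <= y / b ^ L < / b ^ L).
    { split; [apply Rmult_le_pos; lra |].
      rewrite <- (Rmult_1_l (/ b ^ L)); apply Rmult_lt_compat_r; lra. }
    destruct (Hcov (a + y / b ^ L)) as [Hk | [k Hk]].
    + unfold Rdiv in *; lra.
    + split; [unfold Rdiv in *; lra |].
      apply in_A_of_orbit with L; rewrite Hbr; [easy | lra].
    + now left.
    + right; exists (S k); rewrite <- Hk; field; lra.
  - intros k; apply Rmult_le_pos; [easy | lra].
  - intros k x y Hx Hy; specialize (Hdiam k _ _ Hx Hy).
    replace (x - y) with ((a + x / b ^ L - (a + y / b ^ L)) * b ^ L) by (field; lra).
    rewrite Rabs_mult, (Rabs_pos_eq (b ^ L)) by lra.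
    apply Rmult_le_compat_r; lra.
  - exists N.
    rewrite (sum_eq _ (fun k => rpow (r k) s * rpow (b ^ L) s)) in HN
      by (intros; now apply rpow_mult).
    rewrite <- scal_sum in HN.
    assert (HbLs : rpow (b ^ L) s * rpow l s <= C).
    { rewrite <- rpow_mult by lra; apply rpow_le; [easy |].
      split; [apply Rmult_le_pos; lra |].
      apply Rmult_le_reg_r with (/ l); [easy |].
      rewrite Rmult_assoc, Rinv_r, Rmult_1_r by lra.
      unfold L; rewrite pow_add.
      replace (4 * b ^ M * / l) with (b ^ M * (2 * (2 * / l))) by ring.
      apply Rmult_le_compat_l; [lra |].
      apply Rle_trans with (1 := Hn2), Rmult_le_compat_r; lra. }
    set (S := sum_f_R0 _ N) in *.
    pose proof (rpow_gt0 (b ^ L) s HbL) as H0.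
    pose proof (rpow_gt0 l s Hl) as H1.
    apply Rmult_lt_reg_l with (rpow (b ^ L) s); [easy |].
    apply Rle_lt_trans with (2 := HN).
    apply Rmult_le_reg_r with C; [easy |].
    replace (rpow (b ^ L) s * (c0 / C * rpow l s) * C)
      with (c0 * (rpow (b ^ L) s * rpow l s)) by (field; lra).
    apply Rmult_le_compat_l; lra.
Qed.

(** * Points with locally constant digits *)

Fixpoint iterated_preimage (b : R) (k w : nat) : R :=
  match k with
  | O => 0
  | S k => (IZR (word_letter w 0) + iterated_preimage b k (Nat.div2 w)) / b
  end.

(** Inverting one step gives [x = (digit + fbeta b x) / b] with digit 0 or 1, so the bits of [w]
    record the first [k] digits. Hence the points whose orbit reaches 0 are countably many. *)
Lemma orbit_hits_0 b k x :
  1 < b < 2 -> 0 <= x <= 1 -> orbit b k x = 0 -> exists w, x = iterated_preimage b k w.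
Proof.
  intros Hb; revert x; induction k as [| k IH]; intros x Hx H0; [now exists 0%nat |].
  rewrite <- Nat.add_1_r, orbit_add in H0.
  pose proof (orbit_range b 1 x Hx) as Hx1.
  destruct (IH _ Hx1 H0) as [w Hw].
  pose proof (fbeta_range b x) as Hf.
  assert (Hbx : 0 <= b * x < 2).
  { split; [apply Rmult_le_pos; lra |].
    apply Rle_lt_trans with (b * 1); [apply Rmult_le_compat_l; lra | lra]. }
  assert (Hfb : b * x = IZR (Int_part (b * x)) + fbeta b x) by (unfold fbeta; lra).
  change (orbit b 1 x) with (fbeta b x) in Hw.
  assert (Hd : Int_part (b * x) = 0%Z \/ Int_part (b * x) = 1%Z).
  { assert (Int_part (b * x) < 2)%Z by (apply lt_IZR; lra).
    assert (-1 < Int_part (b * x))%Z by (apply lt_IZR; lra). lia. }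
  destruct Hd as [Hd | Hd]; rewrite Hd in Hfb.
  - exists (2 * w)%nat; cbn [iterated_preimage]; rewrite Nat.div2_double, <- Hw.
    unfold word_letter; rewrite Nat.testbit_even_0; simpl Z.b2z.
    rewrite <- Hfb; field; lra.
  - exists (S (2 * w)); cbn [iterated_preimage]; rewrite Nat.div2_succ_double, <- Hw.
    unfold word_letter; replace (S (2 * w)) with (2 * w + 1)%nat by lia.
    rewrite Nat.testbit_odd_0; simpl Z.b2z.
    rewrite <- Hfb; field; lra.
Qed.

(** If the orbit never reaches 0, the points [b * orbit b k x] are never integers; the floors are
    then constant near [x] and the iterate is affine there. *)
Lemma digits_locally_constant b x n :
  1 < b -> 0 <= x <= 1 -> (forall k, orbit b k x <> 0) ->
  exists d, 0 < d /\ forall z, Rabs (z - x) < d ->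
    (forall i, (i < n)%nat -> digit b z i = digit b x i) /\
    orbit b n z - orbit b n x = b ^ n * (z - x).
Proof.
  intros Hb Hx H0; induction n as [| n (d & Hd & IH)].
  - exists 1; split; [lra |]; intros z _; split; [lia | simpl; ring].
  - pose proof (fbeta_range b (orbit b n x)) as Hf.
    specialize (H0 (S n)); rewrite orbit_S in H0.
    assert (Hbn : 0 < b ^ S n) by (apply pow_lt; lra).
    set (y := fbeta b (orbit b n x)) in *.
    (* [g] is the distance from [b * orbit b n x] to the nearest integer. *)
    set (g := Rmin y (1 - y)).
    assert (Hg : 0 < g) by (apply Rmin_glb_lt; lra).
    assert (Hgy : g <= y /\ g <= 1 - y) by (split; [apply Rmin_l | apply Rmin_r]).
    exists (Rmin d (g / b ^ S n)); split.
    { apply Rmin_glb_lt; [easy |].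
      apply Rmult_lt_0_compat; [easy | now apply Rinv_0_lt_compat]. }
    intros z Hz.
    destruct (IH z) as [Hdig Horb].
    { eapply Rlt_le_trans; [apply Hz | apply Rmin_l]. }
    assert (Hzx : Rabs (b ^ S n * (z - x)) < g).
    { rewrite Rabs_mult, (Rabs_pos_eq (b ^ S n)) by lra.
      apply Rmult_lt_reg_r with (/ b ^ S n); [now apply Rinv_0_lt_compat |].
      rewrite (Rmult_comm (b ^ S n)), Rmult_assoc, Rinv_r, Rmult_1_r by lra.
      eapply Rlt_le_trans; [apply Hz | apply Rmin_r]. }
    apply Rabs_def2 in Hzx.
    assert (Hbz : b * orbit b n z = b * orbit b n x + b ^ S n * (z - x)).
    { replace (orbit b n z) with (orbit b n x + b ^ n * (z - x)) by lra.
      simpl; ring. }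
    assert (Hbx : b * orbit b n x = IZR (Int_part (b * orbit b n x)) + y)
      by (unfold y, fbeta; lra).
    assert (Hdn : digit b z n = digit b x n).
    { unfold digit; symmetry; apply Int_part_spec; lra. }
    split.
    + intros i Hi; destruct (Nat.eq_dec i n) as [-> | Hne]; [easy | apply Hdig; lia].
    + rewrite !orbit_S; unfold fbeta; unfold digit in Hdn; rewrite Hdn; lra.
Qed.

Lemma freq_ext b x z m j n :
  (forall i, (i < n)%nat -> digit b z i = digit b x i) ->
  freq b z m j n = freq b x m j n.
Proof.
  intros H; unfold freq, tau; do 3 f_equal.
  apply filter_ext_in; intros i Hi; apply in_seq in Hi.
  unfold occurs_at.
  assert (Hk : forall k, In k (seq 0 m) -> digit b z (i + k) = digit b x (i + k)).
  { intros k Hk; apply in_seq in Hk; apply H; lia. }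
  induction (seq 0 m) as [| k l IH]; simpl in *; [easy |].
  rewrite Hk by auto; f_equal; apply IH; auto.
Qed.

(** The one index [q] controls both the time and the precision, so that membership for all [q]
    amounts to [in_A]. *)
Definition freq_close (b : R) (m : nat) (p : nat -> R) (q : nat) (x : R) : Prop :=
  exists n, (q < n)%nat /\ (m < n)%nat /\
    forall j, (j < 2 ^ m)%nat -> Rabs (freq b x m j n - p j) < / INR (S q).

Lemma in_A_freq_close b m p x : in_A b m x p -> forall q, freq_close b m p q x.
Proof.
  intros HA q; apply HA, Rinv_0_lt_compat, lt_0_INR; lia.
Qed.

Lemma freq_close_in_A b m p x : (forall q, freq_close b m p q x) -> in_A b m x p.
Proof.
  intros HG eps Heps N.
  destruct (INR_unbounded (/ eps)) as [K HK].
  destruct (HG (N + K)%nat) as (n & Hq & Hm & Hn).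
  exists n; split; [lia |]; split; [easy |].
  intros j Hj; eapply Rlt_le_trans; [apply (Hn j Hj) |].
  rewrite <- (Rinv_inv eps); apply Rinv_le_contravar; [now apply Rinv_0_lt_compat |].
  apply Rle_trans with (INR K); [lra | apply le_INR; lia].
Qed.

Lemma freq_close_open b m p q x :
  1 < b -> 0 <= x <= 1 -> (forall k, orbit b k x <> 0) -> freq_close b m p q x ->
  exists d, 0 < d /\ forall z, Rabs (z - x) < d -> freq_close b m p q z.
Proof.
  intros Hb Hx H0 (n & Hq & Hm & Hn).
  destruct (digits_locally_constant b x n Hb Hx H0) as (d & Hd & Hloc).
  exists d; split; [easy |]; intros z Hz; exists n; repeat split; auto.
  intros j Hj; rewrite (freq_ext b x z); [auto | apply Hloc, Hz].
Qed.

(** The exceptional points are those whose orbit reaches 0, so one countable list [e] serves every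
    [q]. *)
Lemma freq_set_interior b m p :
  1 < b < 2 ->
  exists e : nat -> R, forall q x, freq_set b m p x ->
    (exists k, x = e k) \/
    (exists d, 0 < d /\ forall z, Rabs (z - x) < d -> freq_close b m p q z).
Proof.
  intros Hb.
  exists (fun n => iterated_preimage b (fst (of_nat n)) (snd (of_nat n))).
  intros q x [Hx HA].
  destruct (classic (exists k, orbit b k x = 0)) as [[k Hk] | Hne].
  - left; destruct (orbit_hits_0 b k x Hb Hx Hk) as [w Hw].
    exists (to_nat (k, w)); now rewrite cancel_of_to.
  - right; apply freq_close_open; [lra | easy | | now apply in_A_freq_close].
    intros k Hk; apply Hne; now exists k.
Qed.

(** * Dyadic intervals and loads *)

(* Binary numerals encode the dyadic subintervals of [0, 1): [xH] is [0, 1),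
   and [p~0], [p~1] are the left and right halves of [p]. *)
Fixpoint depth (p : positive) : nat :=
  match p with xH => 0 | xO q | xI q => S (depth q) end.

Definition size (p : positive) : R := (1 / 2) ^ depth p.

Fixpoint left (p : positive) : R :=
  match p with xH => 0 | xO q => left q | xI q => left q + size q / 2 end.

Definition right (p : positive) : R := left p + size p.

Definition mem (x : R) (p : positive) : Prop := left p <= x < right p.

(** Ancestry in the binary tree: [p] is obtained from [q] by deleting final bits. *)
Fixpoint inside (q p : positive) : Prop :=
  q = p \/ match q with xH => False | xO q' | xI q' => inside q' p end.

Fixpoint dyadic_at (n : nat) (x : R) : positive :=
  match n with
  | O => xH
  | S n => let p := dyadic_at n x in
           if Rlt_dec x (left p + size p / 2) then xO p else xI p
  end.

Lemma size_pos p : 0 < size p.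
Proof. apply pow_lt; lra. Qed.

Lemma size_half p : size p~0 = size p / 2 /\ size p~1 = size p / 2.
Proof. unfold size; simpl; split; field. Qed.

Lemma inside_refl p : inside p p.
Proof. destruct p; now left. Qed.

Lemma inside_trans r q p : inside r q -> inside q p -> inside r p.
Proof. induction r as [r IH | r IH |]; intros [-> | H] Hq; auto; try easy; right; auto. Qed.

Lemma inside_half p : inside p~0 p /\ inside p~1 p.
Proof. split; right; apply inside_refl. Qed.

Lemma inside_root p : inside p xH.
Proof. induction p; [right | right | left]; easy. Qed.

Lemma inside_bounds q p : inside q p -> left p <= left q /\ right q <= right p.
Proof.
  unfold right; induction q as [q IH | q IH |]; intros [<- | H]; try lra; try easy;
    specialize (IH H); destruct (size_half q) as [H0 H1];
    pose proof (size_pos q); simpl left; lra.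
Qed.

Lemma inside_mem q p x : inside q p -> mem x q -> mem x p.
Proof. intros H; apply inside_bounds in H; unfold mem; lra. Qed.

Lemma inside_depth q p : inside q p -> (depth p <= depth q)%nat.
Proof.
  induction q as [q IH | q IH |]; intros [<- | H]; try easy; specialize (IH H); simpl; lia.
Qed.

Lemma inside_same_depth q p : inside q p -> depth q = depth p -> q = p.
Proof.
  destruct q as [q | q |]; intros [H | H] Hd; try easy;
    apply inside_depth in H; simpl in Hd; lia.
Qed.

Lemma mem_left p : mem (left p) p.
Proof. unfold mem, right; pose proof (size_pos p); lra. Qed.

Lemma halves_disjoint q p : inside q p~0 -> inside q p~1 -> False.
Proof.
  intros H0 H1; apply (inside_mem _ _ _) with (2 := mem_left q) in H0, H1.
  revert H0 H1; unfold mem, right; simpl left.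
  destruct (size_half p); lra.
Qed.

Lemma depth_dyadic_at n x : depth (dyadic_at n x) = n.
Proof.
  induction n as [| n IH]; simpl; [easy |].
  destruct (Rlt_dec _ _); simpl; now rewrite IH.
Qed.

Lemma mem_dyadic_at n x : 0 <= x < 1 -> mem x (dyadic_at n x).
Proof.
  intros Hx; induction n as [| n IH]; [unfold mem, right, size; simpl; lra |].
  simpl; destruct (size_half (dyadic_at n x)); unfold mem, right in *.
  destruct (Rlt_dec _ _); simpl left; lra.
Qed.

Lemma mem_eq_dyadic_at x p : mem x p -> p = dyadic_at (depth p) x.
Proof.
  induction p as [p IH | p IH |]; intros Hx; [| | easy]; simpl;
    rewrite <- IH by (apply (inside_mem _ p) in Hx; [easy | apply inside_half]);
    revert Hx; unfold mem, right; destruct (size_half p); simpl left;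
    intros Hx; destruct (Rlt_dec _ _); (reflexivity || (exfalso; lra)).
Qed.

Lemma inside_dyadic_at n m x : (n <= m)%nat -> inside (dyadic_at m x) (dyadic_at n x).
Proof.
  induction 1 as [| m _ IH]; [apply inside_refl |].
  apply inside_trans with (2 := IH); simpl.
  destruct (Rlt_dec _ _); apply inside_half.
Qed.

Lemma mem_inside x q p : mem x q -> mem x p -> (depth p <= depth q)%nat -> inside q p.
Proof.
  intros Hq Hp Hd.
  rewrite (mem_eq_dyadic_at x q Hq), (mem_eq_dyadic_at x p Hp).
  now apply inside_dyadic_at.
Qed.

Lemma mem_linear x q p : mem x q -> mem x p -> inside q p \/ inside p q.
Proof.
  intros Hq Hp; destruct (le_ge_dec (depth p) (depth q));
    [left | right]; now apply (mem_inside x).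
Qed.

Lemma left_multiple p : exists i, left p = IZR i * size p.
Proof.
  induction p as [p [i IH] | p [i IH] |].
  - exists (2 * i + 1)%Z; destruct (size_half p) as [_ ->].
    simpl left; rewrite IH, plus_IZR, mult_IZR; field.
  - exists (2 * i)%Z; destruct (size_half p) as [-> _].
    simpl left; rewrite IH, mult_IZR; field.
  - exists 0%Z; simpl; ring.
Qed.

Lemma size_small d : 0 < d -> exists n, (1 / 2) ^ n < d.
Proof.
  intros Hd; destruct (pow_lt_1_zero (1 / 2) ltac:(rewrite Rabs_pos_eq; lra) d Hd) as [n Hn].
  exists n; specialize (Hn n ltac:(lia)).
  rewrite Rabs_pos_eq in Hn by (apply pow_le; lra); easy.
Qed.

(** If points of [A] lay in three distinct intervals of depth [n], the outer two points would be
    separated by the whole middle interval, hence by more than [(1 / 2) ^ n]. *)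
Lemma covered_by_two_dyadics (A : R -> Prop) n :
  (forall x y, A x -> A y -> Rabs (x - y) < (1 / 2) ^ n) ->
  exists p q, depth p = n /\ depth q = n /\
    forall x, A x -> 0 <= x < 1 -> mem x p \/ mem x q.
Proof.
  intros Hdiam.
  destruct (classic (exists x, A x /\ 0 <= x < 1)) as [(x & HAx & Hx) | Hne].
  2:{ exists (dyadic_at n 0), (dyadic_at n 0); rewrite depth_dyadic_at.
      do 2 (split; [easy |]); intros x HA Hx; destruct Hne; now exists x. }
  exists (dyadic_at n x).
  destruct (classic (exists y, A y /\ 0 <= y < 1 /\ ~ mem y (dyadic_at n x)))
    as [(y & HAy & Hy & Hyx) | Hne].
  2:{ exists (dyadic_at n 0); rewrite !depth_dyadic_at; do 2 (split; [easy |]).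
      intros y HA Hy; left; apply NNPP; intros H; apply Hne; now exists y. }
  exists (dyadic_at n y); rewrite !depth_dyadic_at; do 2 (split; [easy |]).
  intros z HAz Hz; apply NNPP; intros Hn; apply not_or_and in Hn as [Hzx Hzy].
  pose proof (Hdiam x y HAx HAy) as D1; pose proof (Hdiam x z HAx HAz) as D2;
  pose proof (Hdiam y z HAy HAz) as D3.
  apply Rabs_def2 in D1, D2, D3.
  pose proof (mem_dyadic_at n x Hx) as Mx; pose proof (mem_dyadic_at n y Hy) as My;
  pose proof (mem_dyadic_at n z Hz) as Mz.
  revert Hyx Hzx Hzy Mx My Mz.
  destruct (left_multiple (dyadic_at n x)) as [i Hi];
  destruct (left_multiple (dyadic_at n y)) as [j Hj];
  destruct (left_multiple (dyadic_at n z)) as [k Hk].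
  unfold mem, right; rewrite Hi, Hj, Hk; unfold size; rewrite !depth_dyadic_at.
  set (h := (1 / 2) ^ n) in *.
  assert (Hh : 0 < h) by (apply pow_lt; lra).
  intros Hyx Hzx Hzy Mx My Mz.
  assert (Hgap : forall a b, (a < b)%Z -> (IZR a + 1) * h <= IZR b * h).
  { intros a b Hab; apply Rmult_le_compat_r; [lra |].
    rewrite <- plus_IZR; apply IZR_le; lia. }
  assert (Hij : i <> j) by (intros <-; lra).
  assert (Hik : i <> k) by (intros <-; lra).
  assert (Hjk : j <> k) by (intros <-; lra).
  assert (Hord : (i < j \/ j < i)%Z /\ (i < k \/ k < i)%Z /\ (j < k \/ k < j)%Z) by lia.
  destruct Hord as ([H1 | H1] & [H2 | H2] & [H3 | H3]);
    apply Hgap in H1, H2, H3; lra.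
Qed.

(** * Weights and loads of dyadic intervals *)

Definition weight (s : R) (p : positive) : R := rpow (size p) s.

Lemma weight_pos s p : 0 < weight s p.
Proof. apply rpow_gt0, size_pos. Qed.

Lemma weight_half s p :
  weight s p~0 = weight s p * rpow (1 / 2) s /\ weight s p~1 = weight s p * rpow (1 / 2) s.
Proof.
  unfold weight; destruct (size_half p) as [-> ->].
  pose proof (size_pos p).
  split; rewrite <- rpow_mult by lra; f_equal; field.
Qed.

Lemma weight_root s : weight s xH = 1.
Proof.
  unfold weight, size; simpl; rewrite rpow_pos_eq by lra.
  unfold Rpower; rewrite ln_1, Rmult_0_r; apply exp_0.
Qed.

(** The lower bound says that two halves together weigh more than the whole, which makes repeated
    halving profitable. *)
Lemma rpow_half_bounds s : 0 < s < 1 -> 1 / 2 < rpow (1 / 2) s < 1.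
Proof.
  intros Hs; rewrite rpow_pos_eq by lra; unfold Rpower.
  assert (Hln : ln (1 / 2) < 0) by (rewrite <- ln_1; apply ln_increasing; lra).
  split.
  - rewrite <- (exp_ln (1 / 2)) at 1 by lra; apply exp_increasing.
    nra.
  - rewrite <- exp_0 at 2; apply exp_increasing; nra.
Qed.

Definition indicator (P : Prop) (a : R) : R :=
  if excluded_middle_informative P then a else 0.

Lemma indicator_true (P : Prop) a : P -> indicator P a = a.
Proof. unfold indicator; destruct (excluded_middle_informative P); easy. Qed.

Lemma indicator_false (P : Prop) a : ~ P -> indicator P a = 0.
Proof. unfold indicator; destruct (excluded_middle_informative P); easy. Qed.

Lemma indicator_ge0 P a : 0 <= a -> 0 <= indicator P a.
Proof. unfold indicator; destruct (excluded_middle_informative P); lra. Qed.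

Lemma indicator_plus P a b : indicator P (a + b) = indicator P a + indicator P b.
Proof. unfold indicator; destruct (excluded_middle_informative P); ring. Qed.

Lemma indicator_le (P Q : Prop) a : (P -> Q) -> 0 <= a -> indicator P a <= indicator Q a.
Proof.
  intros H Ha; unfold indicator.
  destruct (excluded_middle_informative P), (excluded_middle_informative Q); tauto || lra.
Qed.

Lemma sum_indicator_unique (P : nat -> Prop) (Q : Prop) a N :
  0 <= a -> (forall n, P n -> Q) -> (forall n m, P n -> P m -> n = m) ->
  sum_f_R0 (fun n => indicator (P n) a) N <= indicator Q a.
Proof.
  intros Ha HPQ Huniq.
  assert (H : forall N, (forall n, (n <= N)%nat -> ~ P n) ->
                        sum_f_R0 (fun n => indicator (P n) a) N = 0).
  { clear N; induction N as [| N IH]; intros HN; simpl;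
      rewrite indicator_false by (apply HN; lia); [easy |].
    rewrite IH by (intros; apply HN; lia); ring. }
  induction N as [| N IH]; simpl.
  - apply indicator_le; [apply HPQ | easy].
  - destruct (classic (P (S N))) as [HP | HP].
    + rewrite H by (intros n Hn Hp; specialize (Huniq _ _ HP Hp); lia).
      rewrite !indicator_true by eauto; lra.
    + rewrite (indicator_false (P (S N))) by easy; lra.
Qed.

(** Truncation at [M] avoids infinite sums; [light] bounds all truncations at once. *)
Definition load (s : R) (U : nat -> positive) (M : nat) (p : positive) : R :=
  sum_f_R0 (fun k => indicator (inside (U k) p) (weight s (U k))) M.

Lemma load_term_ge0 s (U : nat -> positive) p k : 0 <= indicator (inside (U k) p) (weight s (U k)).
Proof. apply indicator_ge0; left; apply weight_pos. Qed.

Lemma load_mono s U M M' p : (M <= M')%nat -> load s U M p <= load s U M' p.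
Proof. apply sum_le_mono, load_term_ge0. Qed.

Lemma load_inside s U M q p : inside q p -> load s U M q <= load s U M p.
Proof.
  intros H; apply sum_Rle; intros k _; apply indicator_le; [| left; apply weight_pos].
  intros Hk; now apply inside_trans with q.
Qed.

(** No [U k] lies in both halves; equality may fail because [p] itself can be some [U k]. *)
Lemma load_halves s U M p : load s U M p~0 + load s U M p~1 <= load s U M p.
Proof.
  unfold load; rewrite <- plus_sum; apply sum_Rle; intros k _.
  destruct (classic (inside (U k) p~0)) as [H0 | H0].
  - rewrite (indicator_false (inside (U k) p~1)) by (intros H; now apply (halves_disjoint (U k) p)).
    rewrite Rplus_0_r; apply indicator_le; [| left; apply weight_pos].
    intros H; apply inside_trans with (1 := H), inside_half.
  - rewrite (indicator_false (inside (U k) p~0)) by easy.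
    rewrite Rplus_0_l; apply indicator_le; [| left; apply weight_pos].
    intros H; apply inside_trans with (1 := H), inside_half.
Qed.

Definition light (s : R) (U : nat -> positive) (a : R) (p : positive) : Prop :=
  forall M, load s U M p <= a * weight s p.

Definition uncovered (U : nat -> positive) (p : positive) : Prop :=
  forall k, ~ inside p (U k).

Lemma weight_le_load s U k p : inside (U k) p -> weight s (U k) <= load s U k p.
Proof.
  intros H; rewrite <- (indicator_true (inside (U k) p) (weight s (U k))) at 1 by easy.
  apply (term_le_sum (fun k => indicator (inside (U k) p) (weight s (U k)))).
  apply load_term_ge0.
Qed.

(** The interval [U k] lies inside itself, so its load is at least its own weight. *)
Lemma light_not_member s U a p k : a < 1 -> light s U a p -> p <> U k.
Proof.
  intros Ha Hlight ->; specialize (Hlight k).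
  pose proof (weight_le_load s U k (U k) (inside_refl _)).
  pose proof (weight_pos s (U k)); nra.
Qed.

Lemma not_light_member s U a k : a < 1 -> ~ light s U a (U k).
Proof. intros Ha H; now apply (light_not_member s U a (U k) k). Qed.

(** If a half lies inside [U k], either it equals [U k], excluded by lightness, or its parent [p]
    already lies inside [U k]. *)
Lemma uncovered_half s U a p q :
  q = p~0%positive \/ q = p~1%positive ->
  a < 1 -> light s U a q -> uncovered U p -> uncovered U q.
Proof.
  intros Hq Ha Hl Hp k Hin.
  assert (Hne : q <> U k) by now apply (light_not_member s U a).
  destruct Hq as [-> | ->]; destruct Hin as [H | H]; easy || now apply (Hp k).
Qed.

Lemma light_left_half s U a p :
  light s U a p -> light s U (a / rpow (1 / 2) s) p~0.
Proof.
  intros Hl M; destruct (weight_half s p) as [-> _].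
  pose proof (rpow_gt0 (1 / 2) s ltac:(lra)).
  replace (a / rpow (1 / 2) s * (weight s p * rpow (1 / 2) s)) with (a * weight s p)
    by (field; lra).
  eapply Rle_trans; [apply load_inside, inside_half | apply Hl].
Qed.

(** One half receives at most half of the load, while its weight is that of [p] times
    [(1 / 2) ^ s]. *)
Lemma light_some_half s U a p :
  light s U a p ->
  light s U (a / (2 * rpow (1 / 2) s)) p~0 \/ light s U (a / (2 * rpow (1 / 2) s)) p~1.
Proof.
  intros Hl; apply NNPP; intros Hn; apply not_or_and in Hn as [H0 H1].
  apply not_all_ex_not in H0 as [M0 H0], H1 as [M1 H1].
  destruct (weight_half s p) as [W0 W1]; rewrite W0 in H0; rewrite W1 in H1.
  pose proof (rpow_gt0 (1 / 2) s ltac:(lra)).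
  replace (a / (2 * rpow (1 / 2) s) * (weight s p * rpow (1 / 2) s))
    with (a * weight s p / 2) in H0, H1 by (field; lra).
  pose proof (load_mono s U M0 (max M0 M1) p~0 ltac:(lia)).
  pose proof (load_mono s U M1 (max M0 M1) p~1 ltac:(lia)).
  pose proof (load_halves s U (max M0 M1) p).
  specialize (Hl (max M0 M1)); lra.
Qed.

(* Since [s < 1], choosing the lighter half over and over makes the load
   negligible with respect to the weight. *)
Lemma light_descendant s U a p :
  0 < s < 1 -> 0 < a -> light s U (1 / 2) p -> uncovered U p ->
  exists q, inside q p /\ light s U a q /\ uncovered U q.
Proof.
  intros Hs Ha Hl Hp.
  pose proof (rpow_half_bounds s Hs) as Hh.
  (* [rho] is the factor gained in the ratio of load to weight by one halving; [s < 1] makes it less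
     than 1. *)
  set (rho := / (2 * rpow (1 / 2) s)).
  assert (Hrho : 0 < rho < 1).
  { unfold rho; split; [apply Rinv_0_lt_compat; lra |].
    rewrite <- Rinv_1 at 2; apply Rinv_lt_contravar; lra. }
  assert (Hiter : forall n, exists q, inside q p /\ light s U (1 / 2 * rho ^ n) q
                                      /\ uncovered U q).
  { induction n as [| n (q & Hqp & Hlq & Hq)].
    - exists p; simpl; rewrite Rmult_1_r; auto using inside_refl.
    - assert (Hlt : 1 / 2 * rho ^ S n < 1).
      { assert (rho ^ S n <= 1); [| lra].
        rewrite <- (pow1 (S n)); apply pow_incr; lra. }
      assert (Heq : 1 / 2 * rho ^ n / (2 * rpow (1 / 2) s) = 1 / 2 * rho ^ S n)
        by (change (1 / 2 * rho ^ n * rho = 1 / 2 * rho ^ S n); simpl; ring).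
      destruct (light_some_half s U _ q Hlq) as [H | H]; rewrite Heq in H;
        [exists q~0%positive | exists q~1%positive];
        (split; [apply inside_trans with (2 := Hqp), inside_half |]);
        (split; [easy |]); eapply uncovered_half; eauto. }
  destruct (pow_lt_1_zero rho ltac:(rewrite Rabs_pos_eq; lra) a Ha) as [n Hn].
  specialize (Hn n ltac:(lia)); rewrite Rabs_pos_eq in Hn by (apply pow_le; lra).
  destruct (Hiter n) as (q & Hqp & Hlq & Hq).
  exists q; split; [easy |]; split; [| easy].
  intros M; eapply Rle_trans; [apply Hlq |].
  apply Rmult_le_compat_r; [left; apply weight_pos |].
  pose proof (pow_lt rho n ltac:(lra)); lra.
Qed.

(** * Large intersections *)

Definition interior_point (G : R -> Prop) (x : R) : Prop :=
  exists d, 0 < d /\ forall z, Rabs (z - x) < d -> G z.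

(** A quantitative large-intersection property. The constant [c] is the same at every place and
    scale, so it can be applied at each stage of a nested construction. *)
Definition fat (s : R) (G : R -> Prop) : Prop :=
  exists c, 0 < c /\
    forall u l, 0 <= u -> 0 < l -> u + l <= 1 ->
    forall (U : nat -> R -> Prop) (r : nat -> R),
      (forall x, u <= x < u + l -> interior_point G x -> exists k, U k x) ->
      (forall k, 0 <= r k) ->
      (forall k x y, U k x -> U k y -> Rabs (x - y) <= r k) ->
      exists N, c * rpow l s < sum_f_R0 (fun k => rpow (r k) s) N.

(** * Maximal heavy intervals *)

Definition heavy (s : R) (U : nat -> positive) (p : positive) : Prop :=
  ~ light s U (1 / 2) p.

Definition top_heavy (s : R) (U : nat -> positive) (p q : positive) : Prop :=
  inside q p /\ heavy s U q /\
  forall q', inside q' p -> heavy s U q' -> inside q q' -> q' = q.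

(** Passing to a strictly larger heavy interval lowers the depth, so the ascent ends. *)
Lemma top_heavy_exists s U p q :
  inside q p -> heavy s U q -> exists q', top_heavy s U p q' /\ inside q q'.
Proof.
  remember (depth q) as n eqn:Hn; revert q Hn.
  induction n as [n IH] using lt_wf_ind; intros q -> Hqp Hq.
  destruct (classic (exists q', inside q' p /\ heavy s U q' /\ inside q q' /\ q' <> q))
    as [(q' & Hq'p & Hq' & Hin & Hne) | Hnone].
  - destruct (IH (depth q')) with (q := q') as (q'' & Htop & Hin'); auto.
    + pose proof (inside_depth _ _ Hin).
      destruct (Nat.eq_dec (depth q) (depth q')) as [He | He]; [| lia].
      destruct Hne; symmetry; now apply inside_same_depth.
    + exists q''; split; [easy | now apply inside_trans with q'].
  - exists q; split; [| apply inside_refl].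
    split; [easy |]; split; [easy |]; intros q' Hq'p Hq' Hin.
    apply NNPP; intros Hne; apply Hnone; now exists q'.
Qed.

(** Dyadic intervals with a common descendant are nested, and maximality then forces equality. *)
Lemma top_heavy_unique s U p q q' r :
  top_heavy s U p q -> top_heavy s U p q' -> inside r q -> inside r q' -> q = q'.
Proof.
  intros (Hqp & Hq & Hmax) (Hqp' & Hq' & Hmax') Hr Hr'.
  apply inside_mem with (2 := mem_left r) in Hr, Hr'.
  destruct (mem_linear _ _ _ Hr Hr') as [H | H]; [symmetry |]; auto.
Qed.

Lemma of_succ_nat_surj p : exists n, Pos.of_succ_nat n = p.
Proof.
  exists (pred (Pos.to_nat p)).
  pose proof (Pos2Nat.is_pos p).
  rewrite Pos.of_nat_succ, Nat.succ_pred by lia; apply Pos2Nat.id.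
Qed.

(** Exchange the two sums: each [U k] inside [p] lies in at most one maximal heavy interval, so it
    is counted at most once. *)
Lemma top_heavy_load s U p N M :
  sum_f_R0 (fun n => indicator (top_heavy s U p (Pos.of_succ_nat n))
                       (load s U M (Pos.of_succ_nat n))) N <= load s U M p.
Proof.
  set (g k n := indicator (top_heavy s U p (Pos.of_succ_nat n)
                           /\ inside (U k) (Pos.of_succ_nat n)) (weight s (U k))).
  assert (Hg : forall k, sum_f_R0 (g k) N <= indicator (inside (U k) p) (weight s (U k))).
  { intros k; apply sum_indicator_unique; [left; apply weight_pos | |].
    - intros n [[H _] Hin]; now apply inside_trans with (Pos.of_succ_nat n).
    - intros n m [Hn Hkn] [Hm Hkm]; apply SuccNat2Pos.inj.
      now apply (top_heavy_unique s U p _ _ (U k)). }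
  assert (Hand : forall k n, g k n = indicator (top_heavy s U p (Pos.of_succ_nat n))
            (indicator (inside (U k) (Pos.of_succ_nat n)) (weight s (U k)))).
  { intros k n; unfold g, indicator.
    repeat destruct (excluded_middle_informative _); tauto || easy. }
  unfold load; induction M as [| M IH]; simpl.
  - rewrite (sum_eq _ (g 0%nat)) by (intros; now rewrite Hand); apply Hg.
  - rewrite (sum_eq _ (fun n => indicator (top_heavy s U p (Pos.of_succ_nat n))
                (sum_f_R0 (fun k => indicator (inside (U k) (Pos.of_succ_nat n))
                                      (weight s (U k))) M) + g (S M) n)).
    + rewrite plus_sum; apply Rplus_le_compat; [apply IH | apply Hg].
    + intros n _; rewrite Hand; apply indicator_plus.
Qed.

(** Heaviness of each interval shows up at some truncation; for finitely many intervals the largest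
    one serves all. *)
Lemma heavy_witness s U p N :
  exists M, forall n, (n <= N)%nat -> top_heavy s U p (Pos.of_succ_nat n) ->
    1 / 2 * weight s (Pos.of_succ_nat n) <= load s U M (Pos.of_succ_nat n).
Proof.
  assert (H : forall n, exists M, top_heavy s U p (Pos.of_succ_nat n) ->
    1 / 2 * weight s (Pos.of_succ_nat n) <= load s U M (Pos.of_succ_nat n)).
  { intros n; destruct (classic (top_heavy s U p (Pos.of_succ_nat n))) as [Ht | Ht].
    - destruct Ht as (_ & Hh & _); apply not_all_ex_not in Hh as [M HM].
      exists M; lra.
    - exists 0%nat; easy. }
  induction N as [| N [M IH]].
  - destruct (H 0%nat) as [M HM]; exists M; intros n Hn.
    now replace n with 0%nat by lia.
  - destruct (H (S N)) as [M' HM']; exists (max M M'); intros n Hn Ht.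
    destruct (Nat.eq_dec n (S N)) as [-> | Hne].
    + eapply Rle_trans; [apply HM', Ht | apply load_mono; lia].
    + eapply Rle_trans; [apply IH; [lia | easy] | apply load_mono; lia].
Qed.

(** Each maximal heavy interval has load at least half its weight, and these loads add up to at most
    the load of [p]. *)
Lemma top_heavy_weight s U a p N :
  light s U a p ->
  sum_f_R0 (fun n => indicator (top_heavy s U p (Pos.of_succ_nat n))
                       (weight s (Pos.of_succ_nat n))) N <= 2 * a * weight s p.
Proof.
  intros Hl; destruct (heavy_witness s U p N) as [M HM].
  assert (H : sum_f_R0 (fun n => indicator (top_heavy s U p (Pos.of_succ_nat n))
                       (weight s (Pos.of_succ_nat n)) * (1 / 2)) N <= load s U M p).
  { eapply Rle_trans; [| apply (top_heavy_load s U p N M)].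
    apply sum_Rle; intros n Hn; specialize (HM n Hn); unfold indicator.
    destruct (excluded_middle_informative _) as [Ht | Ht]; [specialize (HM Ht) |]; lra. }
  rewrite <- scal_sum in H; specialize (Hl M); lra.
Qed.

(* If no subinterval of [p] worked, every interior point of [G] in [p] would lie
   in a heavy subinterval; the maximal heavy ones are disjoint, hence would cover
   these points more cheaply than [fat] allows. *)
Lemma light_inside_fat s G U :
  0 < s -> fat s G ->
  exists a, 0 < a /\ forall p, light s U a p -> uncovered U p ->
    exists q, inside q p /\ light s U (1 / 2) q /\ uncovered U q /\
      forall x, mem x q -> G x.
Proof.
  (* [top_heavy_weight] doubles the constant, so [c / 2] yields a cover of weight at most
     [c * weight s p], contradicting fatness. *)
  intros Hs (c & Hc & Hfat); exists (c / 2); split; [lra |].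
  intros p Hl Hp; apply NNPP; intros Hnone.
  pose proof (size_pos p) as Hsize.
  assert (H01 : 0 <= left p /\ left p + size p <= 1).
  { pose proof (inside_bounds _ _ (inside_root p)) as H; unfold right, size in H; simpl in H; unfold size; lra. }
  destruct (Hfat (left p) (size p)
    ltac:(lra) ltac:(lra) ltac:(lra)
    (fun n x => top_heavy s U p (Pos.of_succ_nat n) /\ mem x (Pos.of_succ_nat n))
    (fun n => indicator (top_heavy s U p (Pos.of_succ_nat n)) (size (Pos.of_succ_nat n))))
    as [N HN].
  - intros x Hx (d & Hd & HG).
    cut (exists q, inside q p /\ heavy s U q /\ mem x q).
    { intros (q & Hqp & Hq & Hxq).
      destruct (top_heavy_exists s U p q Hqp Hq) as (q' & Htop & Hin).
      destruct (of_succ_nat_surj q') as [n Hn]; exists n; rewrite Hn.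
      split; [easy | now apply inside_mem with q]. }
    (* At this depth the dyadic interval around [x] lies in [p] and within distance [d] of [x],
       hence in [G]. *)
    destruct (size_small d Hd) as [n Hn].
    set (q := dyadic_at (max n (depth p)) x).
    assert (Hxq : mem x q) by (apply mem_dyadic_at; lra).
    assert (Hdq : depth q = max n (depth p)) by apply depth_dyadic_at.
    assert (Hqp : inside q p) by (apply (mem_inside x); [easy | apply Hx | lia]).
    destruct (classic (heavy s U q)) as [Hq | Hq]; [now exists q |].
    apply NNPP in Hq.
    destruct (classic (uncovered U q)) as [Hu | Hu].
    + destruct Hnone; exists q; do 3 (split; [easy |]); intros z Hz; apply HG.
      assert (size q <= (1 / 2) ^ n).
      { unfold size; rewrite Hdq.
        replace (max n (depth p)) with (n + (max n (depth p) - n))%nat by lia.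
        rewrite pow_add; rewrite <- (Rmult_1_r ((1 / 2) ^ n)) at 2.
        apply Rmult_le_compat_l; [apply pow_le; lra |].
        rewrite <- (pow1 (max n (depth p) - n)) at 2; apply pow_incr; lra. }
      unfold mem, right in Hz, Hxq; apply Rabs_def1; lra.
    (* A [U k] containing [q] meets [p] without containing it, so it lies inside [p], and it is
       heavy through its own weight. *)
    + apply not_all_ex_not in Hu as [k Hk]; apply NNPP in Hk.
      exists (U k); split.
      * apply (inside_mem _ _ _ Hk) in Hxq.
        destruct (mem_linear x (U k) p Hxq Hx) as [H | H]; [easy | now destruct (Hp k)].
      * split; [apply not_light_member; lra | now apply inside_mem with q].
  - intros n; apply indicator_ge0; left; apply size_pos.
  - intros n x y [Ht Hx] [_ Hy]; rewrite indicator_true by easy.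
    unfold mem, right in Hx, Hy; apply Rabs_le; lra.
  - pose proof (top_heavy_weight s U (c / 2) p N Hl) as H.
    replace (2 * (c / 2)) with c in H by field.
    fold (weight s p) in HN.
    rewrite (sum_eq _ (fun n => indicator (top_heavy s U p (Pos.of_succ_nat n))
                       (weight s (Pos.of_succ_nat n)))) in HN; [lra |].
    intros n _; unfold indicator; destruct (excluded_middle_informative _);
      [easy | apply rpow_0].
Qed.

(** * The nested construction *)

Definition well_inside (q p : positive) : Prop :=
  (depth p < depth q)%nat /\ left p <= left q /\ right q < right p.

Lemma refine_into_fat s G U p :
  0 < s < 1 -> fat s G -> light s U (1 / 2) p -> uncovered U p ->
  exists q, well_inside q p /\ light s U (1 / 2) q /\ uncovered U q /\
    forall x, mem x q -> G x.
Proof.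
  intros Hs HG Hl Hp.
  destruct (light_inside_fat s G U ltac:(lra) HG) as (a & Ha & Hstep).
  pose proof (rpow_half_bounds s Hs) as Hh.
  (* Taking the left half multiplies the ratio by less than 2, so [2 * a'] must be at most [a] and
     less than 1. The left half is taken to keep the right endpoint strictly inside [p]. *)
  set (a' := Rmin a (1 / 2) / 2).
  assert (Ha' : 0 < a' <= a / 2 /\ a' <= 1 / 4).
  { pose proof (Rmin_l a (1 / 2)); pose proof (Rmin_r a (1 / 2)).
    pose proof (Rmin_glb_lt a (1 / 2) 0 ltac:(lra) ltac:(lra)).
    unfold a'; lra. }
  destruct (light_descendant s U a' p Hs ltac:(lra) Hl Hp) as (q1 & Hq1p & Hl1 & Hq1).
  apply light_left_half in Hl1.
  assert (Hbound : a' / rpow (1 / 2) s < 2 * a').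
  { apply Rmult_lt_reg_r with (rpow (1 / 2) s); [lra |].
    unfold Rdiv; rewrite Rmult_assoc, Rinv_l; nra. }
  assert (Hu : uncovered U q1~0).
  { apply (uncovered_half s U (a' / rpow (1 / 2) s) q1); auto; lra. }
  destruct (Hstep q1~0%positive) as (q & Hq & Hlq & Huq & HqG).
  - intros M; eapply Rle_trans; [apply Hl1 |].
    apply Rmult_le_compat_r; [left; apply weight_pos | lra].
  - easy.
  - exists q; split; [| easy].
    pose proof (inside_depth _ _ Hq) as D1; pose proof (inside_depth _ _ Hq1p) as D2.
    apply inside_bounds in Hq, Hq1p; unfold well_inside; simpl in D1; split; [lia |].
    revert Hq; unfold right; simpl left; destruct (size_half q1) as [-> _].
    pose proof (size_pos q1); unfold right in Hq1p; lra.
Qed.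

(** The supremum of the left ends works; since the right ends decrease strictly, it belongs to every
    half-open interval. *)
Lemma nested_dyadics_meet (I : nat -> positive) :
  (forall n, well_inside (I (S n)) (I n)) ->
  (forall n, (n <= depth (I n))%nat) /\ exists x, forall n, mem x (I n).
Proof.
  intros Hnest; split.
  { induction n as [| n IH]; [lia |]; destruct (Hnest n); lia. }
  assert (Hmono : forall n m, (n <= m)%nat ->
                    left (I n) <= left (I m) /\ right (I m) <= right (I n)).
  { induction 1 as [| m _ IH]; [lra |]; destruct (Hnest m) as (_ & H1 & H2); lra. }
  assert (Hlr : forall n m, left (I n) <= right (I m)).
  { intros n m; destruct (Hmono n (max n m) ltac:(lia)) as [H1 _].
    destruct (Hmono m (max n m) ltac:(lia)) as [_ H2].
    pose proof (size_pos (I (max n m))); unfold right in *; lra. }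
  destruct (completeness (fun t => exists n, t = left (I n))) as [x [Hub Hlub]].
  - exists (right (I 0%nat)); intros t [n ->]; apply Hlr.
  - exists (left (I 0%nat)); now exists 0%nat.
  - exists x; intros n; split; [apply Hub; now exists n |].
    destruct (Hnest n) as (_ & _ & Hr).
    apply Rle_lt_trans with (2 := Hr), Hlub; intros t [k ->]; apply Hlr.
Qed.

Lemma light_point_in_fat_sets s (G : nat -> R -> Prop) U :
  0 < s < 1 -> (forall n, fat s (G n)) ->
  light s U (1 / 2) 1 -> uncovered U 1 ->
  exists x, 0 <= x < 1 /\ (forall n, G n x) /\ forall k, ~ mem x (U k).
Proof.
  intros Hs HG Hl Hu.
  set (next n p := epsilon (inhabits 1%positive) (fun q =>
         well_inside q p /\ light s U (1 / 2) q /\ uncovered U q /\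
         forall x, mem x q -> G n x)).
  set (I := nat_rect (fun _ => positive) 1%positive next).
  assert (Hnext : forall n p, light s U (1 / 2) p -> uncovered U p ->
     well_inside (next n p) p /\ light s U (1 / 2) (next n p) /\ uncovered U (next n p) /\
     forall x, mem x (next n p) -> G n x).
  { intros n p H1 H2; unfold next; apply epsilon_spec; now apply refine_into_fat. }
  assert (HI : forall n, light s U (1 / 2) (I n) /\ uncovered U (I n)).
  { induction n as [| n [IH1 IH2]]; [easy |].
    destruct (Hnext n (I n) IH1 IH2) as (_ & H1 & H2 & _); easy. }
  assert (HS : forall n, well_inside (I (S n)) (I n) /\ forall x, mem x (I (S n)) -> G n x).
  { intros n; destruct (HI n) as [H1 H2].
    destruct (Hnext n (I n) H1 H2) as (H3 & _ & _ & H4); easy. }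
  destruct (nested_dyadics_meet I) as [Hdepth [x Hx]]; [intros n; apply HS |].
  exists x; split; [| split].
  - specialize (Hx 0%nat); unfold mem, right, size in Hx; simpl in Hx; lra.
  - intros n; now apply HS.
  (* [I (depth (U k))] is at least as deep as [U k]; sharing the point [x], it would lie inside
     [U k]. *)
  - intros k Hk; destruct (HI (depth (U k))) as [_ Hunc]; apply (Hunc k).
    now apply (mem_inside x).
Qed.

(** * From arbitrary covers to dyadic ones *)

Lemma sum_halves N : sum_f_R0 (fun k => (1 / 2) ^ S k) N <= 1.
Proof.
  assert (H : sum_f_R0 (fun k => (1 / 2) ^ S k) N = 1 - (1 / 2) ^ S N).
  { induction N as [| N IH]; [simpl; lra |].
    rewrite tech5, IH; simpl; lra. }
  pose proof (pow_lt (1 / 2) (S N) ltac:(lra)); lra.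
Qed.

(* Sets of diameter zero are free in [Hnull], whereas a dyadic interval is not. *)
Lemma positive_radius s r e :
  0 < s -> 0 < e -> 0 <= r <= 1 / 4 ->
  exists r', 0 < r' <= 1 / 4 /\ r <= r' /\ rpow r' s <= rpow r s + e.
Proof.
  intros Hs He Hr; destruct (Req_dec r 0) as [-> | Hr0].
  2:{ exists r; split; [lra |]; split; lra. }
  exists (Rmin (1 / 4) (Rpower e (/ s))).
  pose proof (Rpower_pos e (/ s)) as Hp.
  pose proof (Rmin_glb_lt (1 / 4) (Rpower e (/ s)) 0 ltac:(lra) ltac:(lra)) as Hm.
  pose proof (Rmin_l (1 / 4) (Rpower e (/ s))).
  split; [lra |]; split; [lra |].
  rewrite rpow_0, Rplus_0_l.
  apply Rle_trans with (rpow (Rpower e (/ s)) s).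
  - apply rpow_le; [easy | split; [lra | apply Rmin_r]].
  - rewrite rpow_pos_eq, Rpower_mult, Rinv_l, Rpower_1 by lra; lra.
Qed.

Lemma dyadic_pair_cover s (A : R -> Prop) r e :
  0 < s < 1 -> 0 < e -> 0 <= r <= 1 / 4 ->
  (forall x y, A x -> A y -> Rabs (x - y) <= r) ->
  exists pq : positive * positive,
    weight s (fst pq) <= 4 * (rpow r s + e) /\
    weight s (snd pq) <= 4 * (rpow r s + e) /\
    forall x, A x -> 0 <= x < 1 -> mem x (fst pq) \/ mem x (snd pq).
Proof.
  intros Hs He Hr Hdiam.
  destruct (positive_radius s r e ltac:(lra) He Hr) as (r' & Hr' & Hrr' & Hrs).
  assert (Hinv : 1 <= / (4 * r')).
  { rewrite <- Rinv_1; apply Rinv_le_contravar; lra. }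
  (* This gives [2 * r' <= (1 / 2) ^ n <= 4 * r']: longer than the diameter, yet comparable to
     it. *)
  destruct (pow_first_above 2 (/ (4 * r')) ltac:(lra) Hinv) as (n & Hn1 & Hn2).
  assert (H2n : 0 < 2 ^ n) by (apply pow_lt; lra).
  assert (Hhalf : (1 / 2) ^ n = / 2 ^ n)
    by (unfold Rdiv; rewrite Rmult_1_l; apply pow_inv).
  assert (Hbig : r' < (1 / 2) ^ n <= 4 * r').
  { rewrite Hhalf; split.
    - apply Rlt_le_trans with (2 * r'); [lra |].
      replace (2 * r') with (/ (2 * / (4 * r'))) by (field; lra).
      apply Rinv_le_contravar; easy.
    - rewrite <- (Rinv_inv (4 * r')); apply Rinv_le_contravar; [lra | easy]. }
  destruct (covered_by_two_dyadics A n) as (p & q & Hp & Hq & Hcov).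
  { intros x y Hx Hy; specialize (Hdiam x y Hx Hy); lra. }
  assert (H4 : rpow 4 s <= 4).
  { rewrite rpow_pos_eq by lra; rewrite <- (Rpower_1 4) at 2 by lra.
    apply Rle_Rpower; lra. }
  assert (Hw : forall t, depth t = n -> weight s t <= 4 * (rpow r s + e)).
  { intros t Ht; unfold weight, size; rewrite Ht.
    apply Rle_trans with (rpow (r' * 4) s); [apply rpow_le; lra |].
    rewrite rpow_mult by lra; pose proof (rpow_ge0 r' s).
    apply Rle_trans with (rpow r' s * 4); [apply Rmult_le_compat_l |]; lra. }
  exists (p, q); simpl; auto.
Qed.

Theorem fat_sets_intersection_not_null s (G : nat -> R -> Prop) :
  0 < s < 1 -> (forall n, fat s (G n)) ->
  ~ Hnull s (fun x => 0 <= x < 1 /\ forall n, G n x).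
Proof.
  intros Hs HG Hnull0.
  (* The mesh [1 / 4] suits [dyadic_pair_cover]. Each of the two dyadic families weighs at most
     [4 * (1 / 32 + 1 / 32) = 1 / 4], the second [1 / 32] coming from the added geometric errors, so
     the root has load at most [1 / 2]. *)
  destruct (Hnull0 (1 / 4) (1 / 32) ltac:(lra) ltac:(lra)) as (U & r & Hcov & Hr & Hdiam & Hsum).
  assert (Hpair : forall k, exists pq : positive * positive,
    weight s (fst pq) <= 4 * (rpow (r k) s + (1 / 2) ^ S k * (1 / 32)) /\
    weight s (snd pq) <= 4 * (rpow (r k) s + (1 / 2) ^ S k * (1 / 32)) /\
    forall x, U k x -> 0 <= x < 1 -> mem x (fst pq) \/ mem x (snd pq)).
  { intros k; apply dyadic_pair_cover; auto.
    pose proof (pow_lt (1 / 2) (S k) ltac:(lra)); lra. }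
  set (V k := proj1_sig (constructive_indefinite_description _ (Hpair k))).
  assert (HV : forall k,
    weight s (fst (V k)) <= 4 * (rpow (r k) s + (1 / 2) ^ S k * (1 / 32)) /\
    weight s (snd (V k)) <= 4 * (rpow (r k) s + (1 / 2) ^ S k * (1 / 32)) /\
    forall x, U k x -> 0 <= x < 1 -> mem x (fst (V k)) \/ mem x (snd (V k))).
  { intros k; unfold V; apply proj2_sig. }
  set (W := interleave (fun k => fst (V k)) (fun k => snd (V k))).
  assert (Hbound : forall f : nat -> positive,
    (forall k, weight s (f k) <= 4 * (rpow (r k) s + (1 / 2) ^ S k * (1 / 32))) ->
    forall N, sum_f_R0 (fun k => weight s (f k)) N <= 1 / 4).
  { intros f Hf N.
    apply Rle_trans with (sum_f_R0 (fun k => (rpow (r k) s + (1 / 2) ^ S k * (1 / 32)) * 4) N).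
    - apply sum_Rle; intros k _; specialize (Hf k); lra.
    - rewrite <- scal_sum, plus_sum, <- scal_sum.
      specialize (Hsum N); pose proof (sum_halves N); lra. }
  assert (Htotal : forall N, sum_f_R0 (fun k => weight s (W k)) N <= 1 / 2).
  { intros N.
    rewrite (sum_eq _ (interleave (fun k => weight s (fst (V k)))
                                  (fun k => weight s (snd (V k)))))
      by (intros; apply (interleave_map (weight s))).
    eapply Rle_trans; [apply sum_interleave_le; intros; left; apply weight_pos |].
    pose proof (Hbound (fun k => fst (V k)) (fun k => proj1 (HV k)) N).
    pose proof (Hbound (fun k => snd (V k)) (fun k => proj1 (proj2 (HV k))) N).
    simpl in *; lra. }
  assert (Hlight : light s W (1 / 2) 1).
  { intros M; rewrite weight_root, Rmult_1_r.
    eapply Rle_trans; [| apply (Htotal M)].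
    apply sum_Rle; intros k _; unfold indicator.
    destruct (excluded_middle_informative _); [lra | left; apply weight_pos]. }
  assert (Hunc : uncovered W 1).
  { intros k Hin; destruct Hin as [Hk | []].
    revert Hk; apply (light_not_member s W (1 / 2)); [lra | easy]. }
  destruct (light_point_in_fat_sets s G W Hs HG Hlight Hunc) as (x & Hx & HGx & Hmem).
  destruct (Hcov x) as [k Hk]; [easy |].
  destruct (proj2 (proj2 (HV k)) x Hk Hx) as [H | H].
  - apply (Hmem (2 * k)%nat); unfold W; now rewrite interleave_even.
  - apply (Hmem (S (2 * k))); unfold W; now rewrite interleave_odd.
Qed.

(** * The dimension formula *)

Lemma freq_close_fat b m p s q :
  1 < b < 2 -> expansion_of_one_terminates b -> 0 < s ->
  ~ Hnull s (freq_set b m p) -> fat s (freq_close b m p q).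
Proof.
  intros Hb Hterm Hs Hnot.
  destruct (freq_set_content b m p s Hb Hterm Hs Hnot) as (c & Hc & Hcontent).
  destruct (freq_set_interior b m p Hb) as [e He].
  exists c; split; [easy |]; intros u l Hu Hl Hul U r Hcov.
  apply (Hcontent u l Hu Hl Hul e).
  (* Points of the frequency set not interior to [freq_close] are in the list [e], which the content
     bound allows for free. *)
  intros x Hx HF; destruct (He q x HF) as [H | H]; [now right | left; now apply Hcov].
Qed.

Theorem mainTheorem5
  (beta : nat -> R) (m : nat -> nat) (p : nat -> nat -> R)
  (Hbeta : forall i, 1 < beta i < 2)
  (Hterm : forall i, expansion_of_one_terminates (beta i))
  (Hp : forall i j, (j < 2 ^ m i)%nat -> 0 <= p i j <= 1) :
  is_inf (fun t => exists i, t = dimH (freq_set (beta i) (m i) (p i)))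
         (dimH (fun x => forall i, freq_set (beta i) (m i) (p i) x)).
Proof.
  set (F := fun x => forall i, freq_set (beta i) (m i) (p i) x).
  assert (HF : forall x, F x -> 0 <= x <= 1) by (intros x Hx; apply (Hx 0%nat)).
  assert (HFi : forall i x, freq_set (beta i) (m i) (p i) x -> 0 <= x <= 1)
    by (intros i x [Hx _]; easy).
  destruct (dimH_spec F HF) as [Hlow Hgreatest].
  split.
  - intros t [i ->].
    apply (proj2 (dimH_spec _ (HFi i))); intros s [Hs Hnull_s].
    apply Hlow; split; [easy |]; apply Hnull_incl with (2 := Hnull_s); easy.
  (* If the intersection were [s]-null for some [s < d], then [s] would lie below every single
     dimension, so no frequency set would be [s]-null. *)
  - intros d Hd; apply Hgreatest; intros s [Hs HFnull].
    apply Rnot_lt_le; intros Hsd.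
    assert (Hdi : forall i, s < dimH (freq_set (beta i) (m i) (p i)))
      by (intros i; apply Rlt_le_trans with (1 := Hsd), Hd; now exists i).
    assert (Hs1 : s < 1)
      by (apply Rlt_le_trans with (1 := Hdi 0%nat), dimH_le_1, HFi).
    (* The Cantor pairing merges the indices [i] and [q] into one sequence of fat sets. *)
    apply (fat_sets_intersection_not_null s
      (fun n => let (i, q) := of_nat n in freq_close (beta i) (m i) (p i) q)); [lra | |].
    + intros n; destruct (of_nat n) as [i q]; apply freq_close_fat; auto.
      intros Hnull_i; pose proof (proj1 (dimH_spec _ (HFi i)) s (conj Hs Hnull_i)).
      specialize (Hdi i); lra.
    + apply Hnull_incl with (2 := HFnull); intros x [Hx HG] i; split; [lra |].
      apply freq_close_in_A; intros q; specialize (HG (to_nat (i, q))).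
      now rewrite cancel_of_to in HG.
Qed.
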